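(* Let $\Delta$ be a $1$-dimensional flag simplicial complex on the vertex set $[n]$, and let $p$ be an integer with $2\le p\le\nu(\overline\Delta)$. (1) If $\Delta$ contains an induced subgraph isomorphic to $K_{2+i,\,2p-i}$ for some even integer $i$ satisfying $0\le i\le p$, then $\beta_{j,j+2p+1}(I_\Delta^{[p]})\ne0$ for all $1\le j\le n-2p-1$. (2) If $\Delta$ contains an induced subgraph isomorphic to the crown graph $Cr(2p+1)$ but does not contain an induced subgraph isomorphic to $K_{2+i,\,2p-i}$ for any even integer $i$ satisfying $0\le i\le p$, then $$\beta_{j,j+2p+1}(I_\Delta^{[p]})=0\quad\text{for all }1\le j\le 2p,$$ and $$\beta_{j,j+2p+1}(I_\Delta^{[p]})\ne0\quad\text{for all }2p+1\le j\le n-2p-1.$$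
   Context: A $1$-dimensional flag simplicial complex $\Delta$ on $[n]=\{1,\dots,n\}$ is a $1$-dimensional simplicial complex whose Stanley--Reisner ideal $I_\Delta$ is generated in degree two; equivalently, a triangle-free graph on the vertex set $[n]$ (with at least one edge, isolated vertices allowed). $\overline{\Delta}$ denotes the complement graph on $[n]$, so $I_\Delta=(x_ix_j:\{i,j\}\in E(\overline\Delta))$ is the edge ideal of $\overline\Delta$ in $S=K[x_1,\dots,x_n]$, where $K$ is an arbitrary field. $\nu(\overline\Delta)$ is the largest size of a matching (set of pairwise disjoint edges) of $\overline\Delta$. The squarefree power $I_\Delta^{[p]}$ is generated by the squarefree monomials among the minimal generators of $I_\Delta^p$, i.e. by the products of the variables indexed by the $2p$ vertices of the $p$-matchings of $\overline\Delta$. Graded Betti numbers $\beta_{i,j}(I)$ are those of the minimal graded free $S$-resolution of the ideal $I$ (so $\beta_{0,j}$ counts minimal generators). $K_{a,b}$ is the complete bipartite graph with parts of sizes $a,b$. The crown graph $Cr(m)$ has vertex set $\{u_1,\dots,u_m\}\sqcup\{v_1,\dots,v_m\}$ and edges $\{u_i,v_j\}$ for $i\ne j$. *)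

(* Defs.v *)
From mathcomp Require Import all_boot all_order all_algebra.
From mathcomp Require Import mpoly.
Set Implicit Arguments.
Unset Strict Implicit.
Unset Printing Implicit Defensive.
Import GRing.Theory.
Local Open Scope ring_scope.

(** * Graphs, given by their adjacency relations *)

(* A contains an induced copy of H: an isomorphism of H with an induced
   subgraph of A is an injection that preserves and reflects adjacency. *)
Definition has_induced (T U : finType) (A : rel T) (H : rel U) : Prop :=
  exists f : U -> T, injective f /\ forall x y, A (f x) (f y) = H x y.

Definition edges (T : finType) (A : rel T) : {set {set T}} :=
  [set e : {set T} | [exists x, exists y, A x y && (e == [set x; y])]].

Definition is_matching (T : finType) (A : rel T) (M : {set {set T}}) : bool :=
  (M \subset edges A) && trivIset M.

Definition matching_number (T : finType) (A : rel T) : nat :=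
  (\max_(M : {set {set T}} | is_matching A M) #|M|)%N.

Definition complete_bipartite (a b : nat) : rel ('I_a + 'I_b) := fun x y =>
  match x, y with
  | inl _, inr _ | inr _, inl _ => true
  | _, _ => false
  end.

Definition crown (m : nat) : rel ('I_m + 'I_m) := fun x y =>
  match x, y with
  | inl i, inr j | inr j, inl i => i != j
  | _, _ => false
  end.

(** * Simplicial complexes on the vertex set 'I_n *)

(* Every element of 'I_n is required to be a vertex. *)
Definition simplicial_complex (n : nat) (D : {set {set 'I_n}}) : Prop :=
  (forall A B : {set 'I_n}, B \subset A -> A \in D -> B \in D)
  /\ (forall i : 'I_n, [set i] \in D).

Definition has_dim (n : nat) (D : {set {set 'I_n}}) (d : nat) : Prop :=
  (\max_(A in D) #|A| = d.+1)%N.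

Definition skeleton1 (n : nat) (D : {set {set 'I_n}}) : rel 'I_n :=
  fun i j => (i != j) && ([set i; j] \in D).

Definition co_skeleton1 (n : nat) (D : {set {set 'I_n}}) : rel 'I_n :=
  fun i j => (i != j) && ([set i; j] \notin D).

(** * Ideals of K[x_0, ..., x_(n-1)], as predicates *)

Definition ideal_gen (K : fieldType) (n : nat) (G : {mpoly K[n]} -> Prop)
    (f : {mpoly K[n]}) : Prop :=
  exists2 s : seq ({mpoly K[n]} * {mpoly K[n]}),
    (forall c, c \in s -> G c.2) & f = \sum_(c <- s) c.1 * c.2.

Definition ideal_pow (K : fieldType) (n : nat) (I : {mpoly K[n]} -> Prop)
    (p : nat) : {mpoly K[n]} -> Prop :=
  ideal_gen (fun g => exists s : seq {mpoly K[n]},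
    [/\ size s = p, forall x, x \in s -> I x & g = \prod_(x <- s) x]).

Definition stanley_reisner (K : fieldType) (n : nat) (D : {set {set 'I_n}}) :
    {mpoly K[n]} -> Prop :=
  ideal_gen (fun g =>
    exists2 A : {set 'I_n}, A \notin D & g = \prod_(i in A) 'X_i).

Definition generated_in_degree (K : fieldType) (n : nat)
    (I : {mpoly K[n]} -> Prop) (d : nat) : Prop :=
  exists2 G : {mpoly K[n]} -> Prop,
    (forall g, G g -> g \is d.-homog) & (forall f, I f <-> ideal_gen G f).

Definition flag (K : fieldType) (n : nat) (D : {set {set 'I_n}}) : Prop :=
  generated_in_degree (@stanley_reisner K n D) 2.

(* For a monomial ideal J these monomials are the minimal generators of J. *)
Definition min_monomial_gen (K : fieldType) (n : nat)
    (J : {mpoly K[n]} -> Prop) (m : 'X_{1..n}) : Prop :=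
  J 'X_[m] /\ forall m' : 'X_{1..n}, J 'X_[m'] -> (m' <= m)%MM -> m' = m.

Definition squarefree (n : nat) (m : 'X_{1..n}) : Prop :=
  forall i, (m i <= 1)%N.

Definition sqfree_power (K : fieldType) (n : nat) (I : {mpoly K[n]} -> Prop)
    (p : nat) : {mpoly K[n]} -> Prop :=
  ideal_gen (fun g => exists m : 'X_{1..n},
    [/\ min_monomial_gen (ideal_pow I p) m, squarefree m & g = 'X_[m]]).

(** * Minimal graded free resolutions *)

(* Free modules S^r are modules of row vectors; linear maps act on the right.
   The module in homological position i is the direct sum of the S(- gdeg i a),
   and gaug is the map from position 0 to S. *)
Record graded_free (K : fieldType) (n : nat) := GradedFree {
  grank : nat -> nat;
  gdeg : forall i, 'I_(grank i) -> nat;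
  gdiff : forall i, 'M[{mpoly K[n]}]_(grank i.+1, grank i);
  gaug : 'cV[{mpoly K[n]}]_(grank 0)
}.

(* The maps preserve degrees. *)
Definition gf_homogeneous (K : fieldType) (n : nat) (F : graded_free K n) :
    Prop :=
  (forall a, gaug F a 0 \is (gdeg a).-homog) /\
  (forall i a b, gdiff F i a b = 0 \/
     exists2 d, gdeg a = (gdeg b + d)%N & gdiff F i a b \is d.-homog).

Definition gf_resolves (K : fieldType) (n : nat) (F : graded_free K n)
    (I : {mpoly K[n]} -> Prop) : Prop :=
  [/\ forall f, I f <-> exists v : 'rV_(grank F 0), (v *m gaug F) 0 0 = f,
      forall v : 'rV_(grank F 0),
        v *m gaug F = 0 <-> exists w, v = w *m gdiff F 0
    & forall i (v : 'rV_(grank F i.+1)),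
        v *m gdiff F i = 0 <-> exists w, v = w *m gdiff F i.+1].

(* All entries of the differentials lie in the ideal (x_0, ..., x_(n-1)). *)
Definition gf_minimal (K : fieldType) (n : nat) (F : graded_free K n) : Prop :=
  forall i a b, (gdiff F i a b)@_0%MM = 0.

Definition minimal_graded_free_resolution (K : fieldType) (n : nat)
    (I : {mpoly K[n]} -> Prop) (F : graded_free K n) : Prop :=
  [/\ gf_homogeneous F, gf_resolves F I & gf_minimal F].

(* The multiplicity of S(- j) in homological position i.  When F is a minimal
   graded free resolution of I, unique up to isomorphism, this is
   beta_(i,j)(I). *)
Definition betti (K : fieldType) (n : nat) (F : graded_free K n) (i j : nat) :
    nat :=
  #|[set a : 'I_(grank F i) | gdeg a == j]|.

(* Main.v *)
(* Write G for the triangle-free graph [skeleton1 D].  A set of 2p vertices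
   fails to carry a perfect matching of the complement of G exactly when G induces on
   it a complete bipartite graph with two odd parts, so these "odd" sets are
   the only 2p-sets outside the generators of J = I^[p].  Let Gamma be the
   complex whose faces are the sets containing no generator of J: it has all
   sets of size < 2p, the odd sets are its facets of size 2p, and it has no
   larger face.  Hence H_(2p-1)(Gamma_W) is the space of cycles supported on odd
   sets, and beta_(j,j+2p+1)(J) <> 0 iff some W with |W| = j+2p+1 carries a
   nonzero such cycle.

   - An induced K_(a,b) with a, b even and a+b = 2p+2 carries the join of the
     boundaries of two simplices.
   - A crown Cr(2p+1) carries the cycle of all stars {u_k} + V - {v_k, v_l}.
   - Without an induced K_(even,even) on 2p+2 vertices, exchanging vertices of a
     facet K_(A,B) of a nonzero cycle produces #|A| + 1 vertices outside B that
     are nonadjacent to B and #|B| + 1 vertices outside A that are nonadjacent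
     to A, so the cycle involves at least 4p+2 vertices, i.e. j > 2p.

   Betti numbers are read off the Koszul homology of J by chasing cycles through
   the double complex Koszul (x) F. *)

Require Import Defs.
From mathcomp Require Import all_boot all_order all_algebra.
From mathcomp Require Import mpoly.
From mathcomp Require Import ring zify.
Set Implicit Arguments.
Unset Strict Implicit.
Unset Printing Implicit Defensive.
Import GRing.Theory.
Local Open Scope ring_scope.

(** * Simplicial chains *)

Definition inversions (n : nat) (k : 'I_n) (T : {set 'I_n}) : nat :=
  #|[set t in T | (t < k)%N]|.

(** The reduced simplicial boundary of the full simplex, read off coefficientwise. The empty set
    counts as a face, and a chain may mix dimensions. *)
Definition bd (K : fieldType) (n : nat) (f : {ffun {set 'I_n} -> K}) :
    {ffun {set 'I_n} -> K} :=
  [ffun T : {set 'I_n} =>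
     \sum_(k | k \notin T) (-1) ^+ inversions k T * f (k |: T)].

Definition cobd (K : fieldType) (n : nat) (f : {ffun {set 'I_n} -> K}) :
    {ffun {set 'I_n} -> K} :=
  [ffun T : {set 'I_n} =>
     \sum_(k in T) (-1) ^+ inversions k (T :\ k) * f (T :\ k)].

Definition cone (K : fieldType) (n : nat) (k : 'I_n)
    (f : {ffun {set 'I_n} -> K}) : {ffun {set 'I_n} -> K} :=
  [ffun T : {set 'I_n} =>
     if k \in T then (-1) ^+ inversions k (T :\ k) * f (T :\ k) else 0].

Section Chains.
Variables (K : fieldType) (n : nat).
Implicit Types (f g : {ffun {set 'I_n} -> K}) (T W : {set 'I_n}) (k l : 'I_n).

Lemma inversionsU1 k l T : l \notin T ->
  inversions k (l |: T) = ((l < k)%N + inversions k T)%N.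
Proof.
move=> lT; rewrite /inversions.
have -> : [set t in l |: T | (t < k)%N] =
   if (l < k)%N then l |: [set t in T | (t < k)%N] else [set t in T | (t < k)%N].
  apply/setP=> t; case: ifP => lk; rewrite !inE; case: eqP => //= ->;
  by rewrite ?lk ?andbF // (negbTE lT).
by case: ifP => lk; rewrite ?cardsU1 ?inE ?(negbTE lT) ?lk.
Qed.

(** Exactly one of k < l and l < k holds, so the two orders of insertion differ by one inversion. *)
Lemma sign_swap k l T : k != l -> k \notin T -> l \notin T ->
  (-1) ^+ inversions k T * (-1) ^+ inversions l (k |: T) =
  - ((-1) ^+ inversions l T * (-1) ^+ inversions k (l |: T)) :> K.
Proof.
move=> kl kT lT; rewrite !inversionsU1 // !exprD.
case: (ltngtP k l) => [||/val_inj e] /=; last by rewrite e eqxx in kl.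
- by move=> _; rewrite expr0 expr1; ring.
- by move=> _; rewrite expr0 expr1; ring.
Qed.

(** The terms with l < k are cancelled against those with k < l, so the argument is valid in
    characteristic 2 as well. *)
Lemma antisym_sum0 (P : pred 'I_n) (a : 'I_n -> 'I_n -> K) :
  (forall k l, P k -> P l -> k != l -> a k l = - a l k) ->
  \sum_(k | P k) \sum_(l | P l && (l != k)) a k l = 0.
Proof.
move=> anti.
have -> : \sum_(k | P k) \sum_(l | P l && (l != k)) a k l =
   \sum_(k | P k) \sum_(l | P l && (l < k)%N) a k l +
   \sum_(k | P k) \sum_(l | P l && (k < l)%N) a k l.
  rewrite -big_split /=; apply: eq_bigr => k Pk.
  rewrite (bigID (fun l : 'I_n => (l < k)%N)) /=; congr (_ + _);
  apply: eq_bigl => l; rewrite -andbA; congr (_ && _);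
  by rewrite -val_eqE /=; case: ltngtP.
rewrite [X in _ + X](exchange_big_dep P) /=; last by move=> k l _ /andP[].
rewrite -big_split /=; apply: big1 => k Pk.
have -> : \sum_(i < n | P i && (P k && (i < k)%N)) a i k =
    \sum_(l | P l && (l < k)%N) a l k by apply: eq_bigl => l; rewrite Pk.
rewrite -big_split /=; apply: big1 => l /andP[Pl lk].
by rewrite anti ?addNr // -val_eqE /= gtn_eqF.
Qed.

Lemma sub_ffunE f g T : (f - g) T = f T - g T.
Proof. by rewrite !ffunE. Qed.

Lemma bdD f g : bd (f + g) = bd f + bd g.
Proof.
apply/ffunP=> T; rewrite !ffunE -big_split /=; apply: eq_bigr => k _.
by rewrite !ffunE mulrDr.
Qed.

Lemma bdB (f g : {ffun {set 'I_n} -> K}) : bd (f - g) = bd f - bd g.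
Proof.
apply/ffunP=> T; rewrite !ffunE -sumrB; apply: eq_bigr => k _.
by rewrite !ffunE mulrBr.
Qed.

Lemma bd0 : bd (0 : {ffun {set 'I_n} -> K}) = 0.
Proof.
by apply/ffunP=> T; rewrite !ffunE big1 // => k _; rewrite ffunE mulr0.
Qed.

Lemma bd_sum (I : finType) (f : I -> {ffun {set 'I_n} -> K}) :
  bd (\sum_i f i) = \sum_i bd (f i).
Proof. by apply: (big_morph _ bdD bd0). Qed.

Lemma bd_scale (c : K) f : bd [ffun T => c * f T] = [ffun T => c * bd f T].
Proof.
apply/ffunP=> T; rewrite !ffunE mulr_sumr; apply: eq_bigr => k _.
by rewrite ffunE mulrCA.
Qed.

Lemma bd_bd f : bd (bd f) = 0.
Proof.
apply/ffunP=> T; rewrite !ffunE.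
rewrite -[RHS](@antisym_sum0 (fun k => k \notin T) (fun k l =>
  (-1) ^+ inversions k T * (-1) ^+ inversions l (k |: T) * f (l |: (k |: T)))).
  apply: eq_bigr => k kT; rewrite ffunE mulr_sumr.
  apply: eq_big => [l|l _]; last by rewrite mulrA.
  by rewrite !inE negb_or andbC.
by move=> k l kT lT kl; rewrite sign_swap // mulNr setUCA.
Qed.

Lemma sqr_sign m : (-1) ^+ m * (-1) ^+ m = 1 :> K.
Proof. by rewrite -expr2 sqrr_sign. Qed.

(** [cone k] is a contracting homotopy of the full simplex. At a set containing k, the cycle
    equation at T - k expresses f T through the terms that occur in the boundary of the cone. *)
Lemma bd_cone k f : bd f = 0 -> bd (cone k f) = f.
Proof.
move=> f0; apply/ffunP=> T; rewrite ffunE.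
have [kT|kT] := boolP (k \in T); last first.
  rewrite (bigD1 k) //= big1 ?addr0 => [|l /andP[lT lk]].
    by rewrite ffunE setU11 setU1K // mulrA sqr_sign mul1r.
  by rewrite ffunE !inE eq_sym (negbTE lk) (negbTE kT) /= mulr0.
set U := T :\ k; have kU : k \notin U by rewrite setD11.
have TU : T = k |: U by rewrite setD1K.
have /ffunP/(_ U) := f0; rewrite !ffunE (bigD1 k) //= -TU => /eqP.
rewrite addr_eq0 => /eqP fT.
have := congr1 (fun x => (-1) ^+ inversions k U * x) fT.
rewrite mulrA sqr_sign mul1r => ->; rewrite mulrN mulr_sumr -sumrN.
apply: eq_big => [l|l lT].
  by rewrite TU !inE negb_or andbC.
have lU : l \notin U by apply: contra lT; rewrite inE => /andP[].
have kl : k != l by apply: contraNneq lT => <-.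
rewrite ffunE !inE kT orbT /= TU setUCA setU1K; last by rewrite !inE negb_or kl eqxx.
rewrite !mulrA -mulNr; congr (_ * _).
have := sign_swap kl kU lU => /(congr1 (fun x => x * (-1) ^+ inversions l (k |: U)
  * (-1) ^+ inversions l U)).
set a := (-1) ^+ inversions k U; set b := (-1) ^+ inversions l (k |: U).
set c := (-1) ^+ inversions l U; set d := (-1) ^+ inversions k (l |: U).
have -> : a * b * b * c = a * c * (b * b) by ring.
have -> : - (c * d) * b * c = - (b * d * (c * c)) by ring.
by rewrite !sqr_sign !mulr1 => ->; rewrite opprK.
Qed.

Lemma cone_neq0 k f T : cone k f T != 0 -> k \in T /\ f (T :\ k) != 0.
Proof.
rewrite ffunE; case: ifP => [kT|]; last by rewrite eqxx.
by rewrite mulf_eq0 signr_eq0.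
Qed.

Lemma bd_neq0 f T : bd f T != 0 -> exists2 k, k \notin T & f (k |: T) != 0.
Proof.
rewrite ffunE => h; apply/exists_inP; apply: contraR h.
rewrite negb_exists_in => /forall_inP h; rewrite big1 // => k kT.
by move/h: kT => /negPn/eqP->; rewrite mulr0.
Qed.

Lemma bd_cobd f g :
  \sum_(T : {set 'I_n}) bd f T * g T = \sum_(T : {set 'I_n}) f T * cobd g T.
Proof.
transitivity (\sum_k \sum_(T : {set 'I_n} | k \notin T)
    (-1) ^+ inversions k T * f (k |: T) * g T).
  rewrite (exchange_big_dep predT) //=; apply: eq_bigr => T _.
  by rewrite ffunE mulr_suml.
transitivity (\sum_k \sum_(T : {set 'I_n} | k \in T)
    (-1) ^+ inversions k (T :\ k) * f T * g (T :\ k)).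
  apply: eq_bigr => k _.
  rewrite (reindex_onto (fun T => T :\ k) (fun T => k |: T)) /=; last first.
    by move=> T kT; rewrite setU1K.
  rewrite [LHS](eq_bigl (fun T : {set 'I_n} => k \in T)) => [|T].
    by apply: eq_bigr => T kT; rewrite setD1K.
  rewrite setD11 /=; apply/eqP/idP => [<-|kT]; first by rewrite setU11.
  by rewrite setD1K.
rewrite (exchange_big_dep predT) //=.
apply: eq_bigr => T _; rewrite ffunE mulr_sumr; apply: eq_bigr => k _.
by rewrite [_ * f T]mulrC -mulrA.
Qed.

End Chains.

(** * The Koszul complex *)

Definition chain (K : fieldType) (n r : nat) : zmodType :=
  {ffun {set 'I_n} -> 'rV[{mpoly K[n]}]_r}.

(* The Koszul differential; the summand Lambda^q of the exterior algebra is the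
   set of chains supported on the sets of cardinality q. *)
Definition kz (K : fieldType) (n r : nat) (u : chain K n r) : chain K n r :=
  [ffun T : {set 'I_n} =>
     \sum_(k | k \notin T) ((-1) ^+ inversions k T * 'X_k) *: u (k |: T)].

Definition cmul (K : fieldType) (n r s : nat) (u : chain K n r)
    (M : 'M[{mpoly K[n]}]_(r, s)) : chain K n s :=
  [ffun T => u T *m M].

(* The multidegree mu part of the entry [a] of a chain: on it, the Koszul
   differential becomes [bd]. *)
Definition strand (K : fieldType) (n r : nat) (u : chain K n r) (a : 'I_r)
    (mu : 'X_{1..n}) : {ffun {set 'I_n} -> K} :=
  [ffun T => if (mesym1 T <= mu)%MM then (u T 0 a)@_(mu - mesym1 T) else 0].

Section Koszul.
Variables (K : fieldType) (n : nat).
Implicit Types (T W : {set 'I_n}) (k l : 'I_n) (m mu : 'X_{1..n}).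

Lemma mesym1_mem T i : mesym1 T i = (i \in T) :> nat.
Proof. exact: mnmE. Qed.

Lemma mesym1_le T mu : reflect (forall i, i \in T -> 0 < mu i)%N (mesym1 T <= mu)%MM.
Proof.
apply: (iffP mnm_lepP) => h i; have := h i; rewrite mesym1_mem.
  by move=> h1 iT; rewrite iT in h1.
by case: (i \in T) => // ->.
Qed.

Lemma mesym1U T k mu : k \notin T ->
  (mesym1 (k |: T) <= mu)%MM =
  (mesym1 T <= mu)%MM && (U_(k) <= mu - mesym1 T)%MM.
Proof.
move=> kT; apply/mesym1_le/andP => [h|[/mesym1_le h /mnm_lepP/(_ k)] hk i].
  split; first by apply/mesym1_le => i iT; apply: h; rewrite inE iT orbT.
  apply/mnm_lepP=> i; rewrite mnm1E mnmBE mesym1_mem.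
  case: eqP => // <-; rewrite (negbTE kT) subn0; apply: h; exact: setU11.
rewrite !inE => /predU1P[->|]; last exact: h.
by move: hk; rewrite mnm1E mnmBE mesym1_mem eqxx (negbTE kT) subn0.
Qed.

Lemma mesym1_sub T k mu : k \notin T ->
  (mu - mesym1 (k |: T) = mu - mesym1 T - U_(k))%MM.
Proof.
move=> kT; apply/mnmP=> i; rewrite !mnmBE !mesym1_mem mnm1E !inE.
case: (k =P i) => [<-|]; first by rewrite eqxx (negbTE kT) subn0.
by move/eqP; rewrite eq_sym => /negbTE ->; rewrite subn0.
Qed.

Lemma mcoeffXUM k (f : {mpoly K[n]}) m :
  ('X_k * f)@_m = if (U_(k) <= m)%MM then f@_(m - U_(k)) else 0.
Proof.
case: ifP => h.
  by have e := submK h; rewrite addmC in e; rewrite mulrC -[in LHS]e mcoeffMX.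
apply/eqP; rewrite mcoeff_eq0; apply/negP => /msuppM_le/allpairsP[[a b]] /=.
rewrite msuppX inE => -[/eqP -> _ mE]; move: h; rewrite mE.
by rewrite lem_addr.
Qed.

Lemma strand_kz r (u : chain K n r) a mu :
  strand (kz u) a mu = bd (strand u a mu).
Proof.
apply/ffunP=> T; rewrite !ffunE.
case: ifP => h; last first.
  by rewrite big1 // => k kT; rewrite ffunE mesym1U // h mulr0.
rewrite summxE raddf_sum; apply: eq_bigr => k kT.
rewrite ffunE mesym1U // h /= mxE -mulrA -signr_odd mulr_sign.
rewrite -[in RHS]signr_odd mulr_sign mesym1_sub //.
by case: ifP => _; rewrite ?mcoeffN mcoeffXUM; case: ifP.
Qed.

Lemma strand_inj r (u v : chain K n r) :
  (forall a mu, strand u a mu = strand v a mu) -> u = v.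
Proof.
move=> h; apply/ffunP=> T; apply/rowP=> a; apply/mpolyP => m.
have /ffunP/(_ T) := h a (m + mesym1 T)%MM; rewrite !ffunE lem_addl.
by rewrite addmK.
Qed.

Lemma strandB r (u v : chain K n r) a mu :
  strand (u - v) a mu = strand u a mu - strand v a mu.
Proof.
apply/ffunP=> T; rewrite !ffunE !mxE mcoeffB.
by case: ifP; rewrite ?subr0.
Qed.

Lemma strand0 r a mu : strand (0 : chain K n r) a mu = 0.
Proof.
by apply/ffunP=> T; rewrite !ffunE mxE mcoeff0 if_same.
Qed.

Lemma coef_strand r (u : chain K n r) a m T :
  (u T 0 a)@_m = strand u a (m + mesym1 T)%MM T.
Proof. by rewrite ffunE lem_addl addmK. Qed.

Lemma kzB r (u v : chain K n r) : kz (u - v) = kz u - kz v.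
Proof. by apply: strand_inj => a mu; rewrite strandB !strand_kz strandB bdB. Qed.

Lemma kz_kz r (u : chain K n r) : kz (kz u) = 0.
Proof. by apply: strand_inj => a mu; rewrite !strand_kz bd_bd strand0. Qed.

Lemma kz_cmul r s (u : chain K n r) (M : 'M_(r, s)) :
  kz (cmul u M) = cmul (kz u) M.
Proof.
apply/ffunP=> T; rewrite !ffunE mulmx_suml; apply: eq_bigr => k _.
by rewrite ffunE scalemxAl.
Qed.

Lemma cmulB r s (u v : chain K n r) (M : 'M_(r, s)) :
  cmul (u - v) M = cmul u M - cmul v M.
Proof. by apply/ffunP=> T; rewrite !ffunE mulmxBl. Qed.

(** A chain can be prescribed strand by strand. The list [L] keeps the number of nonzero strands
    finite, so that the coefficients are polynomials. *)
Lemma strand_assemble r (phi : 'I_r -> 'X_{1..n} -> {ffun {set 'I_n} -> K})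
    (L : seq 'X_{1..n}) :
  (forall a mu, phi a mu != 0 -> mu \in L) ->
  (forall a mu T, phi a mu T != 0 -> (mesym1 T <= mu)%MM) ->
  exists c : chain K n r, forall a mu, strand c a mu = phi a mu.
Proof.
move=> phiL phis.
exists [ffun T => \row_a \sum_(mu <- undup L | (mesym1 T <= mu)%MM)
   phi a mu T *: 'X_[mu - mesym1 T]].
move=> a mu; apply/ffunP=> T; rewrite !ffunE !mxE.
case: ifPn => [Tmu|]; last by move/(contraNN (phis a mu T)) => /negPn/eqP.
rewrite raddf_sum /=.
have off nu : nu != mu -> (mesym1 T <= nu)%MM ->
    (phi a nu T *: 'X_[nu - mesym1 T] : {mpoly K[n]})@_(mu - mesym1 T) = 0.
  move=> ne Tnu; rewrite mcoeffZ mcoeffX.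
  case: eqP => [e|]; last by rewrite mulr0.
  by rewrite -(submK Tnu) e submK // eqxx in ne.
have [muL|muL] := boolP (mu \in L).
  rewrite big_mkcond (bigD1_seq mu) ?undup_uniq ?mem_undup //= Tmu.
  rewrite big1 ?addr0 => [|nu ne]; last by case: ifP => // Tnu; rewrite off.
  by rewrite mcoeffZ mcoeffX eqxx mulr1.
rewrite big_seq_cond big1 => [|nu /andP[]]; last first.
  rewrite mem_undup => nuL Tnu; rewrite off //.
  by apply: contraNneq muL => <-.
by move/(contraNN (phiL a mu)): muL => /negPn/eqP ->; rewrite ffunE.
Qed.

Lemma strand_finite r (u : chain K n r) :
  exists L : seq 'X_{1..n}, forall a mu, strand u a mu != 0 -> mu \in L.
Proof.
exists [seq (m + mesym1 x.1)%MM | x <- enum {: {set 'I_n} * 'I_r},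
   m <- msupp (u x.1 0 x.2)] => a mu h.
have /existsP[T] : [exists T, strand u a mu T != 0].
  apply: contraR h; rewrite negb_exists => /forallP h.
  by apply/eqP/ffunP => T; rewrite [RHS]ffunE; apply/eqP/negPn.
rewrite ffunE; case: ifP => Tmu; last by rewrite eqxx.
move=> h1; apply/allpairsPdep; exists (T, a), (mu - mesym1 T)%MM.
by rewrite mem_enum mcoeff_msupp submK.
Qed.

(** Koszul boundaries are solved for one multidegree at a time. The predicate [R] records a support
    condition on the solution, such as having coefficients in a monomial ideal. *)
Lemma kz_lift r (u : chain K n r) (R : 'I_r -> 'X_{1..n} -> pred {set 'I_n}) :
  (forall a mu, exists phi, bd phi = strand u a mu /\
     forall T, phi T != 0 -> (mesym1 T <= mu)%MM && R a mu T) ->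
  exists2 c, kz c = u & forall a mu T, strand c a mu T != 0 -> R a mu T.
Proof.
move=> ex; have [L uL] := strand_finite u.
have ex' a mu : exists phi, (bd phi == strand u a mu) &&
    [forall T, (phi T != 0) ==> (mesym1 T <= mu)%MM && R a mu T].
  have [phi [e h]] := ex a mu; exists phi; rewrite e eqxx /=.
  by apply/forallP => T; apply/implyP; exact: h.
(* Outside [L] the strand of u is zero; choosing 0 there keeps the solution finite. *)
pose phi a mu := if mu \in L then xchoose (ex' a mu) else 0.
have phi_ok a mu : bd (phi a mu) = strand u a mu /\ forall T,
    phi a mu T != 0 -> (mesym1 T <= mu)%MM && R a mu T.
  rewrite /phi; case: ifP => [_|/negbT muL].
    have /andP[/eqP-> /forallP h] := xchooseP (ex' a mu).
    by split=> // T; apply/implyP.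
  split=> [|T]; last by rewrite ffunE eqxx.
  by move/(contraNN (uL a mu)): muL => /negPn/eqP ->; rewrite bd0.
have [||c cE] := @strand_assemble r phi L.
- by move=> a mu; rewrite /phi; case: ifP => //; rewrite eqxx.
- by move=> a mu T /(proj2 (phi_ok a mu))/andP[].
exists c; first by apply: strand_inj => a mu; rewrite strand_kz cE; case: (phi_ok a mu).
by move=> a mu T; rewrite cE => /(proj2 (phi_ok a mu))/andP[].
Qed.

Lemma strand_supp r (u : chain K n r) a mu T :
  strand u a mu T != 0 -> (mesym1 T <= mu)%MM.
Proof. by rewrite ffunE; case: ifP => //; rewrite eqxx. Qed.

(** If the multidegree has a positive exponent at k, coning with k inverts the boundary. In
    multidegree 0 only the constant coefficient at the empty set could survive, and it is assumed to
    vanish. *)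
Lemma kz_exact r (u : chain K n r) (R : 'I_r -> 'X_{1..n} -> pred {set 'I_n}) :
  kz u = 0 -> (forall a, (u set0 0 a)@_0 = 0) ->
  (forall a mu T k, strand u a mu T != 0 -> k \notin T -> R a mu (k |: T)) ->
  exists c, [/\ kz c = u, c set0 = 0 &
    forall a mu T, strand c a mu T != 0 -> R a mu T].
Proof.
move=> u0 uc uR.
have [a mu|c <- cR] := @kz_lift r u (fun a mu T => (T != set0) && R a mu T).
  have bu : bd (strand u a mu) = 0 by rewrite -strand_kz u0 strand0.
  have [k muk|mu0] := pickP (fun k => 0 < mu k)%N.
    exists (cone k (strand u a mu)); split; first exact: bd_cone.
    move=> T /cone_neq0[kT h].
    rewrite -(setD1K kT) uR // ?setD11 // andbT setD1K //.
    apply/andP; split; last by apply/set0Pn; exists k.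
    move/strand_supp/mesym1_le: h => h; apply/mesym1_le => i iT.
    by have [->//|ik] := eqVneq i k; apply: h; rewrite !inE ik.
  exists 0; split=> [|T]; last by rewrite ffunE eqxx.
  rewrite bd0; apply/ffunP=> T; rewrite [RHS]ffunE; case: ifP => [h|]; last by rewrite ffunE.
  have -> : T = set0.
    apply/setP=> i; rewrite inE; apply/negP=> iT.
    by move/mesym1_le/(_ i iT): h; rewrite mu0.
  have -> : (mu - mesym1 set0 = 0)%MM.
    apply/mnmP=> i; rewrite mnmBE mnm0E; have := mu0 i; by case: (mu i).
  by rewrite uc ffunE.
exists c; split=> // [|a mu T /cR/andP[]//].
apply/rowP=> a; apply/mpolyP=> m; rewrite mxE mcoeff0 coef_strand.
by apply/eqP/negPn/negP => /cR; rewrite eqxx.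
Qed.

End Koszul.

(** * Betti numbers and Koszul homology *)

Definition mfilter (K : fieldType) (n : nat) (P : pred 'X_{1..n})
    (f : {mpoly K[n]}) : {mpoly K[n]} :=
  \sum_(m <- msupp f | P m) f@_m *: 'X_[m].

(* Position q and total degree d in Koszul (x) F. *)
Definition supported (K : fieldType) (n r : nat) (g : 'I_r -> nat) (q d : nat)
    (u : chain K n r) : Prop :=
  forall T a m, (u T 0 a)@_m != 0 -> #|T| = q /\ (mdeg m + q + g a)%N = d.

Section Resolutions.
Variables (K : fieldType) (n : nat).
Implicit Types (T W : {set 'I_n}) (m mu : 'X_{1..n}).

Lemma mcoeff_mfilter (P : pred 'X_{1..n}) (f : {mpoly K[n]}) m :
  (mfilter P f)@_m = if P m then f@_m else 0.
Proof.
rewrite raddf_sum big_mkcond /=.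
have z k : k != m -> (if P k then (f@_k *: 'X_[k] : {mpoly K[n]})@_m else 0) = 0.
  by move=> km; rewrite mcoeffZ mcoeffX (negbTE km) mulr0 if_same.
have [mf|mf] := boolP (m \in msupp f); last first.
  rewrite big_seq big1 => [|k kf]; last first.
    by rewrite z //; apply: contraNneq mf => <-.
  by rewrite (memN_msupp_eq0 mf) if_same.
rewrite (bigD1_seq m) ?msupp_uniq //= big1 ?addr0 => [|k]; last exact: z.
by rewrite mcoeffZ mcoeffX eqxx mulr1.
Qed.

Lemma mcoeffM_neq0 (p q : {mpoly K[n]}) m : (p * q)@_m != 0 ->
  exists m1 m2, [/\ p@_m1 != 0, q@_m2 != 0 & m = (m1 + m2)%MM].
Proof.
rewrite -mcoeff_msupp => /msuppM_le/allpairsP[[m1 m2] /= [h1 h2 ->]].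
by exists m1, m2; rewrite -!mcoeff_msupp.
Qed.

Lemma mcoeff0M (p q : {mpoly K[n]}) : q@_0 = 0 -> (p * q)@_0 = 0.
Proof.
move=> q0; apply/eqP/negPn/negP => /mcoeffM_neq0[m1 [m2 [_ h /esym/eqP]]].
by rewrite mnmD_eq0 => /andP[_ /eqP m20]; rewrite m20 q0 eqxx in h.
Qed.

Variables (rk : nat -> nat) (g : forall i, 'I_(rk i) -> nat)
  (D : forall i, 'M[{mpoly K[n]}]_(rk i.+1, rk i)).
Arguments g {i}.
Hypothesis D_hom : forall i a b m, (D i a b)@_m != 0 -> g a = (g b + mdeg m)%N.
Hypothesis D_exact : forall i (v : 'rV_(rk i.+1)),
  v *m D i = 0 <-> exists w, v = w *m D i.+1.

Lemma kz_supported i q d (u : chain K n (rk i)) :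
  supported (@g i) q.+1 d u -> supported (@g i) q d (kz u).
Proof.
move=> su T a m; rewrite coef_strand strand_kz => /bd_neq0[k kT].
rewrite ffunE; case: ifP => [h|]; last by rewrite eqxx.
move=> /su; rewrite mesym1_sub // addmK cardsU1 kT => -[e1 e2].
split; first by case: e1.
move: h; rewrite mesym1U // addmK => /andP[_ h].
by rewrite -(submK h) mdegD mdeg1 -e2; lia.
Qed.

Lemma mfilter_mul (p q : {mpoly K[n]}) (P Q : pred 'X_{1..n}) :
  (forall m1 m2, q@_m2 != 0 -> P m1 = Q (m1 + m2)%MM) ->
  mfilter P p * q = mfilter Q (p * q).
Proof.
move=> PQ; apply/mpolyP => m; rewrite mcoeff_mfilter !mcoeffM.
case: ifP => Qm; [apply: eq_bigr|apply: big1] => -[k1 k2] /= /eqP mE;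
  rewrite mcoeff_mfilter;
  have [->|/(PQ (bmnm k1))] := eqVneq q@_k2 0; rewrite ?mulr0 //.
  by move=> ->; rewrite -mE Qm.
by move=> ->; rewrite -mE Qm mul0r.
Qed.

(** An arbitrary lift can be truncated to the terms of the right position and degree: since [D i] is
    homogeneous, truncation commutes with multiplication by it. *)
Lemma lift_supported i q d (u : chain K n (rk i)) :
  supported (@g i) q d u -> (forall T, exists w, u T = w *m D i) ->
  exists2 w : chain K n (rk i.+1),
    supported (@g i.+1) q d w & u = cmul w (D i).
Proof.
move=> su /fin_all_exists[w wE].
pose P r (f : 'I_r -> nat) a (m : 'X_{1..n}) := (mdeg m + q + f a == d)%N.
pose w' : chain K n (rk i.+1) := [ffun T : {set 'I_n} =>
  if #|T| == q then \row_a mfilter (P _ (@g _) a) (w T 0 a) else 0].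
exists w'; first move=> T a m.
  rewrite ffunE; case: ifP => [/eqP Tq|]; last by rewrite mxE mcoeff0 eqxx.
  rewrite mxE mcoeff_mfilter; case: ifP => [/eqP //|]; by rewrite eqxx.
apply/ffunP=> T; rewrite !ffunE; apply/rowP => b; apply/mpolyP => m.
case: ifP => [/eqP Tq|Tq]; last first.
  rewrite mul0mx mxE mcoeff0; apply/eqP/negPn/negP => /su[/eqP].
  by rewrite Tq.
have -> : ((\row_a mfilter (P _ (@g _) a) (w T 0 a)) *m D i) 0 b =
    mfilter (P _ (@g _) b) ((w T *m D i) 0 b).
  rewrite !mxE; transitivity (\sum_j mfilter (P _ (@g _) b) (w T 0 j * D i j b)).
    apply: eq_bigr => j _; rewrite mxE; apply: mfilter_mul => m1 m2 /D_hom e.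
    by rewrite /P e mdegD; apply/eqP/eqP; lia.
  apply/mpolyP => m'; rewrite mcoeff_mfilter !raddf_sum /=.
  case: ifP => h; [apply: eq_bigr|apply: big1] => j _;
  by rewrite mcoeff_mfilter h.
rewrite -wE mcoeff_mfilter; case: ifPn => // h.
by apply/eqP/negPn/negP => /su[_ /eqP e]; rewrite /P e in h.
Qed.

Lemma cmul_supported i q d (w : chain K n (rk i.+1)) :
  supported (@g i.+1) q d w -> supported (@g i) q d (cmul w (D i)).
Proof.
move=> sw T b m; rewrite ffunE mxE raddf_sum /= => h.
have /existsP[a] : [exists a, (w T 0 a * D i a b)@_m != 0].
  apply: contraR h; rewrite negb_exists => /forallP h.
  by rewrite big1 // => a _; apply/eqP/negPn.
move=> /mcoeffM_neq0[m1 [m2 [/sw[-> e] /D_hom e2 ->]]].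
by split=> //; rewrite mdegD; lia.
Qed.

Lemma supported_strand i q d (u : chain K n (rk i)) a mu T :
  supported (@g i) q d u -> strand u a mu T != 0 ->
  #|T| = q /\ (mdeg mu + g a)%N = d.
Proof.
move=> su h; have Tmu := strand_supp h; move: h.
rewrite ffunE Tmu => /su[Tq e]; split=> //.
by rewrite -(submK Tmu) mdegD mdeg_mesym1 Tq.
Qed.

Lemma strand_supported i q d (u : chain K n (rk i)) :
  (forall a mu T, strand u a mu T != 0 -> #|T| = q /\ (mdeg mu + g a)%N = d) ->
  supported (@g i) q d u.
Proof.
move=> su T a m; rewrite coef_strand => /su[Tq].
by rewrite mdegD mdeg_mesym1 Tq.
Qed.

(* If the module in position i + q + 1 has no generator in degree d, then the
   zigzag starting from u ends at a chain with coefficients in the maximal ideal,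
   hence at a Koszul boundary, and one climbs back. *)
Lemma boundary_of_betti0 q i d (u : chain K n (rk i)) :
  supported (@g i) q d u -> kz u = 0 -> (forall T, exists w, u T = w *m D i) ->
  (forall a : 'I_(rk (i + q).+1), g a <> d) ->
  exists e : chain K n (rk i.+1), u = kz (cmul e (D i)) /\ e set0 = 0.
Proof.
elim: q i u => [|q IHq] i u su u0 /(lift_supported su)[w sw uE] gd.
  (* For q = 0 the chain w lives on the empty set alone, hence is a cycle; a constant coefficient of
     w would belong to a generator of degree d, which [gd] excludes. *)
  have w0 : kz w = 0.
    apply/ffunP=> T; rewrite !ffunE big1 // => k kT.
    have -> : w (k |: T) = 0; last by rewrite scaler0.
    apply/rowP=> a; apply/mpolyP=> m; rewrite mxE mcoeff0.
    by apply/eqP/negPn/negP => /sw[]; rewrite cardsU1 kT.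
  have [a||e [eE e0 _]] := @kz_exact K n _ w (fun _ _ => predT) w0 => //.
    apply/eqP/negPn/negP => /sw[_]; rewrite mdeg0 !add0n.
    by move: gd; rewrite addn0; apply.
  by exists e; rewrite kz_cmul eE.
have u'D T : exists v, kz w T = v *m D i.+1.
  apply/D_exact; have /ffunP/(_ T) := u0.
  by rewrite uE kz_cmul !ffunE.
have [||||e' [e'E e'0]] := IHq i.+1 (kz w).
- exact: kz_supported.
- exact: kz_kz.
- exact: u'D.
- by rewrite addSnnS.
(* Correcting w by e' makes it a Koszul cycle without changing its image under [D i], because
   consecutive differentials compose to zero. *)
have w0 : kz (w - cmul e' (D i.+1)) = 0 by rewrite kzB -e'E subrr.
have [a||e [eE e0 _]] := @kz_exact K n _ _ (fun _ _ => predT) w0 => //.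
  rewrite !ffunE e'0 mul0mx subr0.
  by apply/eqP/negPn/negP => /sw[]; rewrite cards0.
exists e; split=> //; rewrite kz_cmul eE cmulB -uE.
have -> : cmul (cmul e' (D i.+1)) (D i) = 0; last by rewrite subr0.
apply/ffunP=> T; rewrite !ffunE; apply/D_exact.
by exists (e' T).
Qed.

(* The inverse of the connecting map H_(q+1)(im D_i) -> H_q(im D_(i+1)). *)
Lemma descend_nonboundary i q d (u : chain K n (rk i.+1)) :
  (q = 0%N -> forall a b, (D i.+1 a b)@_0 = 0) ->
  supported (@g i.+1) q d u -> kz u = 0 ->
  (forall T, exists w, u T = w *m D i.+1) ->
  ~ (exists e, u = kz (cmul e (D i.+1))) ->
  exists u' : chain K n (rk i), [/\ supported (@g i) q.+1 d u', kz u' = 0,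
    forall T, exists w, u' T = w *m D i & ~ exists e, u' = kz (cmul e (D i))].
Proof.
move=> Dmin su u0 uD unb.
have [a|a mu T k /(supported_strand su)[<- e] kT|c [cE c0 cR]] :=
  @kz_exact K n _ u (fun a mu T => (#|T| == q.+1) && (mdeg mu + g a == d)%N) u0.
(* For q = 0 the constant terms of u vanish because the entries of [D i.+1] have none; for q > 0 the
   chain u is zero on the empty set. *)
- have [q0|q0] := eqVneq q 0.
    have [w ->] := uD set0; rewrite mxE raddf_sum big1 // => b _.
    by rewrite /= mcoeff0M // Dmin.
  by apply/eqP/negPn/negP => /su[]; rewrite cards0 => /esym/eqP; rewrite (negbTE q0).
- by rewrite cardsU1 kT e !eqxx.
exists (cmul c (D i)); split.
- apply: cmul_supported; apply: strand_supported => a mu T /cR.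
  by case/andP => /eqP -> /eqP.
- by rewrite kz_cmul cE; apply/ffunP=> T; rewrite !ffunE; apply/D_exact.
- by move=> T; rewrite ffunE; exists (c T).
move=> [e eE]; apply: unb.
(* If the new chain were the boundary of e, then c - kz e would lift through [D i.+1], and applying
   [kz] would present u as a boundary. *)
have /fin_all_exists[w wE] T : exists w, (c - kz e) T = w *m D i.+1.
  apply/D_exact; have /ffunP/(_ T) := cmulB c (kz e) (D i).
  by rewrite -kz_cmul -eE subrr !ffunE.
exists [ffun T => w T].
have -> : cmul [ffun T => w T] (D i.+1) = c - kz e.
  by apply/ffunP=> T; rewrite [LHS]ffunE ffunE -wE.
by rewrite kzB kz_kz subr0 cE.
Qed.

Lemma nonboundary_descends i q d (u : chain K n (rk i)) :
  (q = 0%N -> (0 < i)%N -> forall a b, (D i a b)@_0 = 0) ->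
  supported (@g i) q d u -> kz u = 0 ->
  (forall T, exists w, u T = w *m D i) ->
  ~ (exists e, u = kz (cmul e (D i))) ->
  exists u' : chain K n (rk 0), [/\ supported (@g 0) (i + q) d u', kz u' = 0,
    forall T, exists w, u' T = w *m D 0 & ~ exists e, u' = kz (cmul e (D 0))].
Proof.
elim: i q u => [|i IHi] q u Dmin su u0 uD unb; first by exists u.
have [//|u' [su' u'0 u'D u'nb]] := descend_nonboundary _ su u0 uD unb.
  by move=> q0; apply: Dmin.
by rewrite addSnnS; apply: IHi su' u'0 u'D u'nb.
Qed.

(** The descent starts from the basis vector at [a0], placed on the empty set and mapped by [D i].
    Were this a boundary, the basis vector would be the sum of a Koszul boundary and an element of
    the image of [D i.+1]; both have zero constant terms, whereas its own constant term at [a0] is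
    1. Minimality of [D i] is asked only for i > 0, since [D 0] will be the augmentation. *)
Lemma nonboundary_of_betti i d (a0 : 'I_(rk i.+1)) :
  (forall a b, (D i.+1 a b)@_0 = 0) ->
  ((0 < i)%N -> forall a b, (D i a b)@_0 = 0) -> g a0 = d ->
  exists u' : chain K n (rk 0), [/\ supported (@g 0) i d u', kz u' = 0,
    forall T, exists w, u' T = w *m D 0 & ~ exists e, u' = kz (cmul e (D 0))].
Proof.
move=> Dmin1 Dmin ga.
pose v : chain K n (rk i.+1) := [ffun T => if T == set0 then delta_mx 0 a0 else 0].
have sv : supported (@g i.+1) 0 d v.
  move=> T a m; rewrite ffunE; case: (T =P set0) => [->|_]; last first.
    by rewrite mxE mcoeff0 eqxx.
  rewrite mxE eqxx /=; have [->|_] := eqVneq a a0; last by rewrite mcoeff0 eqxx.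
  rewrite mcoeff1 cards0; case: (m =P 0%MM) => [->|_]; last by rewrite eqxx.
  by rewrite mdeg0 ga.
have [|||||u'] := @nonboundary_descends i 0 d (cmul v (D i)).
- by move=> _.
- exact: cmul_supported.
- rewrite kz_cmul; apply/ffunP=> T; rewrite !ffunE big1 ?mul0mx // => k kT.
  rewrite ffunE; case: eqP => [/setP/(_ k)|]; last by rewrite scaler0.
  by rewrite setU11 inE.
- by move=> T; rewrite ffunE; exists (v T).
- move=> [e]; rewrite kz_cmul => /ffunP/(_ set0) /eqP.
  rewrite ![cmul _ _ _]ffunE -subr_eq0 -mulmxBl => /eqP /D_exact[w] /rowP/(_ a0)/eqP.
  have : ((v set0 - kz e set0) 0 a0)@_0 = 1.
    rewrite !ffunE eqxx !mxE !eqxx mcoeffB mcoeff1 eqxx summxE raddf_sum.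
    rewrite big1 ?subr0 // => k _; rewrite /= mxE mulrAC.
    apply: mcoeff0M.
    by rewrite mcoeffX mnm1_eq0.
  move=> e1 /eqP e2; move: e1; rewrite e2 mxE raddf_sum big1 => [/eqP|b _].
    by rewrite eq_sym oner_eq0.
  by rewrite /= mcoeff0M // Dmin1.
by rewrite addn0; exists u'.
Qed.

End Resolutions.

(** * Matchings of the complement of a triangle-free graph *)

(** The graph induced on F is complete bipartite with parts X and F - X; either part may be
    empty. *)
Definition bipartition (T : finType) (A : rel T) (F X : {set T}) : bool :=
  (X \subset F) &&
  [forall x in F, forall y in F, A x y == (x \in X) (+) (y \in X)].

Definition odd_bip (T : finType) (A : rel T) (F : {set T}) : bool :=
  [exists X, [&& bipartition A F X, odd #|X| & odd #|F :\: X|]].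

(* The complement of the graph has a perfect matching on the set. *)
Inductive co_matchable (T : finType) (A : rel T) : {set T} -> Prop :=
| CoMatchable0 : co_matchable A set0
| CoMatchable2 x y (F : {set T}) : x != y -> ~~ A x y -> x \notin F -> y \notin F ->
    co_matchable A F -> co_matchable A (x |: (y |: F)).

Lemma disjointsU1 (T : finType) (x : T) (F W : {set T}) :
  [disjoint x |: F & W] = (x \notin W) && [disjoint F & W].
Proof. by rewrite -setI_eq0 setIUl setU_eq0 !setI_eq0 disjoints1. Qed.

Section Graphs.
Variables (T : finType) (A : rel T).
Hypotheses (A_sym : forall x y, A x y = A y x) (A_irr : irreflexive A).
Hypothesis A_tf : forall x y z, A x y -> A y z -> A x z = false.
Implicit Types (F W X Y P : {set T}) (v w x y z : T).

Lemma bipartitionP F X : reflect (X \subset F /\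
    {in F &, forall x y, A x y = (x \in X) (+) (y \in X)}) (bipartition A F X).
Proof.
apply: (iffP andP) => -[XF h]; split=> //.
  by move=> x y xF yF; apply/eqP; move/forall_inP/(_ x xF)/forall_inP/(_ y yF): h.
by apply/forall_inP => x xF; apply/forall_inP => y yF; rewrite h.
Qed.

Lemma bipartitionC F X : bipartition A F X -> bipartition A F (F :\: X).
Proof.
move/bipartitionP=> [XF h]; apply/bipartitionP; split; first exact: subsetDl.
by move=> x y xF yF; rewrite h // !inE xF yF !andbT addbN addNb negbK.
Qed.

Lemma bipartition_join X Y : [disjoint X & Y] ->
  {in X &, forall x y, ~~ A x y} -> {in Y &, forall x y, ~~ A x y} ->
  {in X & Y, forall x y, A x y} -> bipartition A (X :|: Y) X.
Proof.
move=> dXY hX hY hXY; apply/bipartitionP; split; first exact: subsetUl.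
have nX y : y \in Y -> y \in X = false.
  by move=> yY; apply/negbTE; apply: contraL yY => /(disjointFr dXY) ->.
move=> x y; rewrite !inE; case/orP=> [xX|xY] /orP[yX|yY].
- by rewrite xX yX (negbTE (hX _ _ xX yX)).
- by rewrite xX (nX _ yY) hXY.
- by rewrite A_sym yX (nX _ xY) hXY.
- by rewrite (nX _ xY) (nX _ yY) (negbTE (hY _ _ xY yY)).
Qed.

Lemma co_matchableU F W : [disjoint F & W] ->
  co_matchable A F -> co_matchable A W -> co_matchable A (F :|: W).
Proof.
move=> dFW mF mW; elim: mF dFW => [|x y {}F xy Axy xF yF mF IH]; first by rewrite set0U.
rewrite !disjointsU1 => /and3P[xW yW dFW].
rewrite -!setUA; apply: CoMatchable2; rewrite ?inE ?negb_or ?xF ?yF //.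
exact: IH.
Qed.

Lemma co_matchable_indep F : ~~ odd #|F| -> {in F &, forall x y, ~~ A x y} ->
  co_matchable A F.
Proof.
have [m] := ubnP #|F|; elim: m F => // m IH F Fm Fe Fi.
have [->|[x xF]] := set_0Vmem F; first exact: CoMatchable0.
have [F0|[y]] := set_0Vmem (F :\ x).
  by move: Fe; rewrite (cardsD1 x) xF F0 cards0.
rewrite !inE => /andP[yx yF].
rewrite -(setD1K xF) -[F :\ x](@setD1K _ y) ?inE ?yx //.
have cF : #|F| = #|F :\ x :\ y|.+2.
  by rewrite (cardsD1 x) xF (cardsD1 y (F :\ x)) !inE yx yF.
apply: CoMatchable2; rewrite ?inE ?eqxx ?andbF //.
- by rewrite eq_sym.
- exact: Fi.
apply: IH; first by move: Fm; rewrite cF; lia.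
  by move: Fe; rewrite cF /= negbK.
by move=> a b; rewrite !inE => /and3P[_ _ aF] /and3P[_ _ bF]; apply: Fi.
Qed.

(** Each matched pair is nonadjacent, so it lies entirely inside X or entirely outside, and
    contributes 2 or 0 to the count. *)
Lemma co_matchable_even F X : co_matchable A F ->
  {in F &, forall x y, ~~ A x y -> (x \in X) = (y \in X)} -> ~~ odd #|F :&: X|.
Proof.
elim=> [|x y {}F xy Axy xF yF _ IH] h; first by rewrite set0I cards0.
have xyX : (x \in X) = (y \in X) by apply: h; rewrite // !inE eqxx ?orbT.
rewrite setIUl setIUl.
have IH' : ~~ odd #|F :&: X|.
  by apply: IH => a b aF bF; apply: h; rewrite !inE ?aF ?bF !orbT.
have [xX|xX] := boolP (x \in X).
  have -> : [set x] :&: X = [set x] by apply/setIidPl; rewrite sub1set.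
  have -> : [set y] :&: X = [set y] by apply/setIidPl; rewrite sub1set -xyX.
  by rewrite !cardsU1 !inE (negbTE xF) (negbTE yF) (negbTE xy) /= negbK.
have sx z : z \notin X -> [set z] :&: X = set0.
  by move=> zX; apply/setP=> t; rewrite !inE; case: eqP => // ->; rewrite (negbTE zX).
by rewrite !sx ?set0U // -xyX.
Qed.

Lemma odd_bip_not_co_matchable F : odd_bip A F -> ~ co_matchable A F.
Proof.
case/existsP=> X /and3P[/bipartitionP[XF h] oX _] mF.
have := co_matchable_even mF (X := X); rewrite (setIidPr XF) oX /= => e.
suff : false by [].
apply: e => x y xF yF; rewrite h //.
by case: (x \in X); case: (y \in X).
Qed.

Lemma bipartition_edge F X x y : bipartition A F X -> x \in X ->
  y \in F :\: X -> A x y.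
Proof.
move=> /bipartitionP[XF h] xX; rewrite inE => /andP[yX yF].
by rewrite (h _ _ (subsetP XF _ xX) yF) xX (negbTE yX).
Qed.

Lemma bipartition_indep F X : bipartition A F X ->
  {in X &, forall x y, ~~ A x y}.
Proof.
move=> /bipartitionP[XF h] x y xX yX.
by rewrite (h _ _ (subsetP XF _ xX) (subsetP XF _ yX)) xX yX.
Qed.

Lemma bipartition_coindep F X : bipartition A F X ->
  {in F :\: X &, forall x y, ~~ A x y}.
Proof. by move/bipartitionC/bipartition_indep. Qed.

Lemma disjoint_setD F X : [disjoint X & F :\: X].
Proof. by rewrite -setI_eq0; apply/eqP/setP=> i; rewrite !inE; case: (i \in X). Qed.

Lemma odd_bip_join X Y : [disjoint X & Y] ->
  {in X &, forall x y, ~~ A x y} -> {in Y &, forall x y, ~~ A x y} ->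
  {in X & Y, forall x y, A x y} -> odd #|X| -> odd #|Y| ->
  odd_bip A (X :|: Y).
Proof.
move=> d hX hY hXY oX oY; apply/existsP; exists X; rewrite bipartition_join // oX.
suff -> : (X :|: Y) :\: X = Y by [].
by apply/setP=> i; rewrite !inE; have [/(disjointFr d) ->|] := boolP (i \in X).
Qed.

(** The pairs are c with x, d with y, and any pairing inside the even independent sets X - x and (F
    - X) - y. *)
Lemma co_matchable_insert2 F X c d x y : bipartition A F X ->
  odd #|X| -> odd #|F :\: X| -> c \notin F -> d \notin F -> c != d ->
  x \in X -> y \in F :\: X -> ~~ A c x -> ~~ A d y ->
  co_matchable A (c |: (d |: F)).
Proof.
move=> bF oX oY cF dF cd xX yY cx dy.
have [XF _] := bipartitionP _ _ bF.
have xF : x \in F by apply: (subsetP XF).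
have [yX yF] : y \notin X /\ y \in F by move: yY; rewrite inE => /andP[].
have xy : x != y by apply: contraNneq yX => <-.
have -> : c |: (d |: F) =
    c |: (x |: (d |: (y |: ((X :\ x) :|: (F :\: X :\ y))))).
  apply/setP=> i; rewrite !inE.
  have [->|ix] := eqVneq i x; first by rewrite xF !orbT.
  have [->|iy] := eqVneq i y; first by rewrite yF !orbT.
  have [/(subsetP XF) iF|iX] := boolP (i \in X); rewrite /= ?iF ?orbT //.
have neF z : z \notin F -> z \notin (X :\ x) :|: (F :\: X :\ y).
  move=> zF; rewrite !inE (negbTE zF) !andbF orbF.
  by apply: contra zF => /andP[_ /(subsetP XF)].
have nx z : z \in F -> z != c /\ z != d.
  by move=> zF; split; apply: contraTneq zF => ->.
have [[xc xd] [yc yd]] := (nx _ xF, nx _ yF).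
apply: CoMatchable2 => //; first by rewrite eq_sym.
- by rewrite !in_setU1 !negb_or cd (eq_sym c y) yc neF.
- by rewrite !inE (negbTE xd) (negbTE xy) eqxx xX.
apply: CoMatchable2 => //; first by rewrite eq_sym.
- exact: neF.
- by rewrite !inE eqxx (negbTE yX) andbF.
apply: co_matchableU.
- apply: disjointWl (subsetDl _ _) _; apply: disjointWr (subsetDl _ _) _.
  exact: disjoint_setD.
- apply: co_matchable_indep.
    by move: oX; rewrite (cardsD1 x) xX /=.
  by move=> a b /setD1P[_ aX] /setD1P[_ bX]; apply: (bipartition_indep bF).
- apply: co_matchable_indep.
    by move: oY; rewrite (cardsD1 y) yY /=.
  by move=> a b /setD1P[_ aX] /setD1P[_ bX]; apply: (bipartition_coindep bF).
Qed.

(* Remove two nonadjacent vertices c, d.  If the rest is odd complete bipartite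
   with parts X, Y, then either c and d can be matched with some x in X and y in Y
   and the even sets X - x and Y - y are paired up internally, or triangle-freeness
   forces c and d into the same part. *)
Lemma co_matchable_or_odd_bip F : ~~ odd #|F| -> co_matchable A F \/ odd_bip A F.
Proof.
have [m] := ubnP #|F|; elim: m F => // m IH F Fm Fe.
have [/exists_inP[c cF /exists_inP[d dF /andP[cd Acd]]]|/exists_inPn h] :=
  boolP [exists c in F, exists d in F, (c != d) && ~~ A c d]; last first.
  (* In this case all distinct vertices of F are adjacent, so triangle-freeness leaves at most two
     of them. *)
  have {}h : {in F &, forall x y, x != y -> A x y}.
    move=> x y /h /exists_inPn h1 /h1; rewrite negb_and negbK.
    by case/orP=> [/eqP->|/negPn//]; rewrite eqxx.
  have [->|[x xF]] := set_0Vmem F; first by left; exact: CoMatchable0.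
  have [F0|[y]] := set_0Vmem (F :\ x).
    by move: Fe; rewrite (cardsD1 x) xF F0 cards0.
  rewrite !inE => /andP[yx yF]; have xy : x != y by rewrite eq_sym.
  have -> : F = [set x] :|: [set y].
    apply/setP=> z; rewrite !inE; apply/idP/orP => [zF|[/eqP->|/eqP->]] //.
    have [//|zx] := eqVneq z x; first by left.
    have [//|zy] := eqVneq z y; first by right.
    have := @A_tf z x y; rewrite !h // => /(_ isT isT); by [].
  right; apply: odd_bip_join; rewrite ?cards1 //.
  - by rewrite disjoints1 inE.
  - by move=> a b /set1P-> /set1P->; rewrite A_irr.
  - by move=> a b /set1P-> /set1P->; rewrite A_irr.
  - by move=> a b /set1P-> /set1P->; rewrite h.
pose W := F :\ c :\ d.
have FW : F = c |: (d |: W) by rewrite setD1K ?setD1K // !inE eq_sym cd.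
have cW : c \notin W by rewrite !inE eqxx andbF.
have dW : d \notin W by rewrite !inE eqxx.
clearbody W.
have cardF : #|F| = #|W|.+2 by rewrite FW !cardsU1 in_setU1 negb_or cd cW dW.
have [||mW|/existsP[X /and3P[bX oX oY]]] := IH W.
- by move: Fm; rewrite cardF; lia.
- by move: Fe; rewrite cardF /= negbK.
- by left; rewrite FW; apply: CoMatchable2.
have [/exists_inP[x xX /exists_inP[y yY]]|/exists_inPn h] :=
  boolP [exists x in X, exists y in W :\: X,
    (~~ A c x && ~~ A d y) || (~~ A d x && ~~ A c y)].
  move=> hh; left; move: hh; case/orP => /andP[h1 h2].
    by rewrite FW; apply: (co_matchable_insert2 bX oX oY _ _ _ xX yY).
  rewrite FW setUCA.
  by apply: (co_matchable_insert2 bX oX oY _ _ _ xX yY); rewrite // eq_sym.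
right.
have {}h x y : x \in X -> y \in W :\: X ->
    (A c x || A d y) && (A d x || A c y).
  by move=> /h /exists_inPn h1 /h1; rewrite negb_or !negb_and !negbK.
have X0 : exists x, x \in X.
  by apply/set0Pn; apply: contraTneq oX => ->; rewrite cards0.
have Y0 : exists y, y \in W :\: X.
  by apply/set0Pn; apply: contraTneq oY => ->; rewrite cards0.
have tri z x y : x \in X -> y \in W :\: X -> A z x -> A z y = false.
  by move=> xX yY zx; apply: A_tf zx _; apply: bipartition_edge bX xX yY.
have tri2 z x y : x \in X -> y \in W :\: X -> A z y -> A z x = false.
  by move=> xX yY zy; apply: contraTF zy => /(tri _ _ _ xX yY) ->.
have [x0 x0X] := X0; have [y0 y0Y] := Y0.
have [XW _] := bipartitionP _ _ bX.
have WE : W = X :|: (W :\: X) by rewrite -{1}(setID W X) (setIidPr XW).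
have notin z (S : {set T}) : z \notin W -> S \subset W -> z \notin S.
  by move=> zW SW; apply: contra zW; apply: (subsetP SW).
have YW := subsetDl W X.
have [cX dX] := (notin _ _ cW XW, notin _ _ dW XW).
have [cY dY] := (notin _ _ cW YW, notin _ _ dW YW).
have dXY := disjoint_setD W X.
(* If c is adjacent to x0, then c and d are adjacent to all of X and to nothing in W - X, so both
   join W - X. Otherwise the roles are exchanged and both join X. *)
have [cx0|cx0] := boolP (A c x0).
  have dx0 : A d x0.
    by have /andP[_] := h _ _ x0X y0Y; rewrite (tri c _ _ x0X y0Y cx0) orbF.
  have nY z : z = c \/ z = d -> {in W :\: X, forall y, A z y = false}.
    by move=> zE y yY; apply: (tri z _ _ x0X yY); case: zE => ->.
  have aX z : z = c \/ z = d -> {in X, forall x, A z x}.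
    move=> zE x xX; have := h _ _ xX y0Y.
    rewrite (nY c (or_introl erefl) _ y0Y) (nY d (or_intror erefl) _ y0Y) !orbF.
    by case/andP=> cx dx; case: zE => ->.
  have -> : F = X :|: (c |: (d |: (W :\: X))).
    by rewrite FW {1}WE (setUCA X [set c]) (setUCA X [set d]).
  apply: odd_bip_join => //.
  - rewrite disjoint_sym !disjointsU1 disjoint_sym dXY andbT.
    by rewrite cX dX.
  - exact: bipartition_indep bX.
  - move=> a b /setU1P[->|/setU1P[->|aY]] /setU1P[->|/setU1P[->|bY]];
    rewrite ?A_irr ?(A_sym d c) ?(negbTE Acd) //.
    + by rewrite nY //; left.
    + by rewrite nY //; right.
    + by rewrite A_sym nY //; left.
    + by rewrite A_sym nY //; right.
    + exact: (bipartition_coindep bX).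
  - move=> a b aX' /setU1P[->|/setU1P[->|bY]].
    + by rewrite A_sym aX //; left.
    + by rewrite A_sym aX //; right.
    + exact: (bipartition_edge bX).
  - by rewrite !cardsU1 in_setU1 negb_or cd cY dY /= negbK.
have dy0 : A d y0 by have /andP[] := h _ _ x0X y0Y; rewrite (negbTE cx0).
have cy0 : A c y0.
  by have /andP[_] := h _ _ x0X y0Y; rewrite (tri2 d _ _ x0X y0Y dy0).
have nX z : z = c \/ z = d -> {in X, forall x, A z x = false}.
  by move=> zE x xX; apply: (tri2 z _ _ xX y0Y); case: zE => ->.
have aY z : z = c \/ z = d -> {in W :\: X, forall y, A z y}.
  move=> zE y yY; have := h _ _ x0X yY.
  rewrite (nX c (or_introl erefl) _ x0X) (nX d (or_intror erefl) _ x0X).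
  by case/andP=> dy cy; case: zE => ->.
have -> : F = (c |: (d |: X)) :|: (W :\: X).
  by rewrite FW {1}WE -!setUA.
apply: odd_bip_join => //.
- by rewrite !disjointsU1 dXY andbT cY dY.
- move=> a b /setU1P[->|/setU1P[->|aX]] /setU1P[->|/setU1P[->|bX']];
  rewrite ?A_irr ?(A_sym d c) ?(negbTE Acd) //.
  + by rewrite nX //; left.
  + by rewrite nX //; right.
  + by rewrite A_sym nX //; left.
  + by rewrite A_sym nX //; right.
  + exact: (bipartition_indep bX).
- exact: bipartition_coindep bX.
- move=> a b /setU1P[->|/setU1P[->|aX]] bY.
  + by rewrite aY //; left.
  + by rewrite aY //; right.
  + exact: (bipartition_edge bX).
- by rewrite !cardsU1 in_setU1 negb_or cd cX dX /= negbK.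
Qed.

End Graphs.

(** * Exchanging vertices in odd complete bipartite subgraphs *)

Section Support.
Variables (T : finType) (A : rel T).
Hypotheses (A_sym : forall x y, A x y = A y x) (A_irr : irreflexive A).
Hypothesis A_tf : forall x y z, A x y -> A y z -> A x z = false.
Implicit Types (F W X Y P : {set T}) (v w x y z : T).

Lemma bipartition_setDK F X : bipartition A F X -> F :\: (F :\: X) = X.
Proof. by case/bipartitionP=> XF _; rewrite setDDr setDv set0U (setIidPr XF). Qed.

(** The old and new bipartite structures agree on F - v. If w joined the part opposite to X - v,
    then X - v would be a full part of even size; so w takes the place of v. That w and v are
    nonadjacent follows from their common neighbour. *)
Lemma odd_bip_exchange F X v w : bipartition A F X ->
  odd #|X| -> odd #|F :\: X| -> v \in X -> w \notin F ->
  odd_bip A (w |: F :\ v) ->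
  {in F :\: X, forall y, A w y} /\ {in X, forall x, ~~ A w x}.
Proof.
move=> bF oX oY vX wF /existsP[X2 /and3P[b2 o2 o2']].
have [y0 y0Y] : exists y, y \in F :\: X.
  by apply/set0Pn; apply: contraTneq oY => ->; rewrite cards0.
have [XF _] := bipartitionP _ _ _ bF.
have inF' z : z \in F -> z != v -> z \in w |: F :\ v.
  by move=> zF zv; rewrite !inE zF zv orbT.
have YF' y : y \in F :\: X -> y \in w |: F :\ v.
  rewrite inE => /andP[yX yF]; apply: inF' => //.
  by apply: contraNneq yX => ->.
(* Up to complementation, [X2] is the part missing y0, that is, the one corresponding to X. *)
wlog y0X2 : X2 b2 o2 o2' / y0 \notin X2.
  have [y0X2|] := boolP (y0 \in X2); last by move=> h /(_ X2); apply.
  move=> /(_ ((w |: F :\ v) :\: X2)); apply => //.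
  - exact: bipartitionC.
  - by rewrite bipartition_setDK.
  - by rewrite inE y0X2.
have [X2F h2] := bipartitionP _ _ _ b2.
have YX2 y : y \in F :\: X -> y \notin X2.
  move=> yY; have := h2 _ _ (YF' _ yY) (YF' _ y0Y).
  rewrite (negbTE y0X2) addbF => <-.
  exact: (bipartition_coindep bF).
have XX2 x : x \in X -> x != v -> x \in X2.
  move=> xX xv; have := h2 _ _ (inF' _ (subsetP XF _ xX) xv) (YF' _ y0Y).
  by rewrite (negbTE y0X2) addbF => <-; apply: (bipartition_edge bF).
have wX2 : w \in X2.
  apply: contraTT o2 => wX2.
  have -> : X2 = X :\ v.
    apply/setP=> z; apply/idP/setD1P => [zX2|[zv zX]]; last exact: XX2.
    have := subsetP X2F _ zX2; rewrite !inE => /predU1P[zw|/andP[zv zF]].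
      by rewrite -zw zX2 in wX2.
    split=> //; apply: contraLR zX2 => zX; apply: YX2.
    by rewrite inE zX zF.
  by move: oX; rewrite (cardsD1 v) vX.
have wF' : w \in w |: F :\ v by rewrite setU11.
have wY : {in F :\: X, forall y, A w y}.
  by move=> y yY; rewrite (h2 _ _ wF' (YF' _ yY)) wX2 (negbTE (YX2 _ yY)).
split=> // x xX; have [->|xv] := eqVneq x v; last first.
  by rewrite (h2 _ _ wF' (inF' _ (subsetP XF _ xX) xv)) wX2 XX2.
apply/negP=> wv; have := A_tf (y := w) (x := v) (z := y0).
rewrite A_sym wv wY // => /(_ isT isT).
by rewrite (bipartition_edge bF).
Qed.

(** An odd exchange in one part forces w to be nonadjacent to X, an odd exchange in the other forces
    it to be adjacent to X. Hence F + w always contains a generator of the squarefree power, and odd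
    sets are facets. *)
Lemma odd_bip_insert F w : odd_bip A F -> w \notin F ->
  exists2 v, v \in F & ~~ odd_bip A (w |: F :\ v).
Proof.
move=> /existsP[X /and3P[bF oX oY]] wF.
have [XF _] := bipartitionP _ _ _ bF.
have [x0 x0X] : exists y, y \in X.
  by apply/set0Pn; apply: contraTneq oX => ->; rewrite cards0.
have [y0 y0Y] : exists y, y \in F :\: X.
  by apply/set0Pn; apply: contraTneq oY => ->; rewrite cards0.
have [h|] := boolP (odd_bip A (w |: F :\ x0)); last first.
  by exists x0; rewrite // (subsetP XF).
exists y0; first by move: y0Y; rewrite inE => /andP[].
apply/negP => h'.
have [_ /(_ _ x0X) h1] := odd_bip_exchange bF oX oY x0X wF h.
have [] := odd_bip_exchange (bipartitionC bF) oY _ y0Y wF h'.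
  by rewrite bipartition_setDK.
by rewrite bipartition_setDK // => /(_ _ x0X); rewrite (negbTE h1).
Qed.

Lemma bipartition_exchange F X v w : bipartition A F X -> v \in X ->
  w \notin F ->
  {in F :\: X, forall y, A w y} -> {in X, forall x, ~~ A w x} ->
  bipartition A (w |: F :\ v) (w |: X :\ v) /\
  (w |: F :\ v) :\: (w |: X :\ v) = F :\: X.
Proof.
move=> bF vX wF wY wX; have [XF _] := bipartitionP _ _ _ bF.
have wX' : w \notin X by apply: contra wF; apply: (subsetP XF).
have e : w |: F :\ v = (w |: X :\ v) :|: (F :\: X).
  apply/setP=> z; rewrite !inE; have [->|_] := eqVneq z v.
    by rewrite vX /= !orbF.
  by have [/(subsetP XF)->|] := boolP (z \in X); rewrite /= ?orbT ?orbF.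
have d : [disjoint w |: X :\ v & F :\: X].
  rewrite disjointsU1 inE (negbTE wF) andbF /=.
  by apply: disjointWl (subsetDl _ _) (disjoint_setD _ _).
split.
  rewrite e; apply: (bipartition_join A_sym) => //.
  - move=> a b /setU1P[->|/setD1P[_ aX]] /setU1P[->|/setD1P[_ bX]].
    + by rewrite A_irr.
    + exact: wX.
    + by rewrite A_sym wX.
    + exact: (bipartition_indep bF).
  - exact: (bipartition_coindep bF).
  - move=> a b /setU1P[->|/setD1P[_ aX]] bY; first exact: wY.
    exact: (bipartition_edge bF).
apply/setP=> z; rewrite e in_setD [z \in _ :|: (F :\: X)]in_setU.
have [zY|zY] := boolP (z \in F :\: X); last by rewrite orbF andNb.
by rewrite (disjointFl d zY).
Qed.

(** [Fam] abstracts the support of a cycle: by [Fam_ridge], a ridge of one facet lies on a second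
    facet. [no_even_bip] rules out induced complete bipartite graphs on 2p + 2 vertices with
    nonempty even parts. *)
Variables (Fam : pred {set T}) (p : nat) (W : {set T}).
Hypothesis Fam_sub : forall F, Fam F -> F \subset W.
Hypothesis Fam_card : forall F, Fam F -> #|F| = (2 * p)%N.
Hypothesis Fam_odd : forall F, Fam F -> odd_bip A F.
Hypothesis Fam_ridge : forall F v, Fam F -> v \in F ->
  exists2 w, w \notin F & Fam (w |: F :\ v).
Hypothesis no_even_bip : forall F X, #|F| = (2 * p).+2 -> bipartition A F X ->
  ~~ odd #|X| -> (0 < #|X|)%N -> (0 < #|F :\: X|)%N -> False.

(* Exchanging v in X for a new vertex w, and then a vertex of the other part,
   yields y_v adjacent to w and to X - v.  It is not adjacent to v, as otherwise
   F + w + y_v would be an even complete bipartite graph; hence the y_v are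
   distinct. *)
Lemma far_vertices F X : Fam F -> bipartition A F X -> odd #|X| ->
  odd #|F :\: X| ->
  exists P, [/\ #|P| = #|X|.+1, P \subset W, {in P, forall y, y \notin F :\: X},
    {in P & F :\: X, forall y b, ~~ A y b} &
    {in P, forall y, #|[set x in X | ~~ A y x]| <= 1}%N].
Proof.
move=> FF bF oX oY.
have [XF _] := bipartitionP _ _ _ bF.
have [b bY] : exists y, y \in F :\: X.
  by apply/set0Pn; apply: contraTneq oY => ->; rewrite cards0.
have co G Z z w : Fam G -> bipartition A G Z -> odd #|Z| -> odd #|G :\: Z| ->
    z \in G :\: Z -> w \notin G -> Fam (w |: G :\ z) ->
    {in Z, forall x, A w x} /\ {in G :\: Z, forall y, ~~ A w y}.
  move=> FG bG oZ oZ' zZ wG Fw.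
  have [] := odd_bip_exchange (bipartitionC bG) oZ' _ zZ wG (Fam_odd Fw).
    by rewrite bipartition_setDK.
  by rewrite bipartition_setDK.
have bF' : b \in F by move: bY; rewrite inE => /andP[].
(* This exchange of b alone gives a vertex adjacent to all of X; it accounts for the extra 1 in the
   size of [P]. *)
have [yA yAF FyA] := Fam_ridge FF bF'.
have [yAX yAY] := co _ _ _ _ FF bF oX oY bY yAF FyA.
have inW G z : Fam G -> z \in G -> z \in W.
  by move=> /Fam_sub/subsetP; apply.
have ex v : exists y, v \in X -> [/\ y \in W, y \notin F :\: X,
    {in F :\: X, forall c, ~~ A y c}, ~~ A y v & {in X, forall x, x != v -> A y x}].
  have [vX|] := boolP (v \in X); last by exists v.
  have [w wF Fw] := Fam_ridge FF (subsetP XF _ vX).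
  have [wY wX] := odd_bip_exchange bF oX oY vX wF (Fam_odd Fw).
  have [bv Yv] := bipartition_exchange bF vX wF wY wX.
  have ov : odd #|w |: X :\ v|.
    have wX' : w \notin X by apply: contra wF; apply: (subsetP XF).
    rewrite cardsU1 !inE (negbTE wX') andbF.
    by move: oX; rewrite (cardsD1 v) vX.
  have bF2 : b \in w |: F :\ v.
    by move: bY; rewrite -Yv inE => /andP[].
  have [y yF Fy] := Fam_ridge Fw bF2.
  have [] := co _ _ b y Fw bv ov _ _ yF Fy; rewrite ?Yv // => yX yY.
  exists y => _; split.
  - exact: inW Fy (setU11 _ _).
  - by apply: contra yF; rewrite -Yv inE => /andP[].
  - exact: yY.
  - apply/negP=> yv.
    have yv' : y != v.
      by apply: contraTneq (yX w (setU11 _ _)) => ->; rewrite A_sym wX.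
    have yFF : y \notin F by apply: contra yF => yF; rewrite !inE yv' yF orbT.
    have wX' : w \notin X by apply: contra wF; apply: (subsetP XF).
    have yw : y != w by apply: contraNneq yF => ->; exact: setU11.
    have e : y |: (w |: F) = (w |: X) :|: (y |: F :\: X).
      rewrite -{1}(setID F X) (setIidPr XF) [LHS]setUCA -[RHS]setUA.
      by rewrite (setUCA X).
    have d : [disjoint w |: X & y |: F :\: X].
      rewrite disjointsU1 !inE negb_or eq_sym yw (negbTE wF) andbF /=.
      rewrite disjoint_sym disjointsU1 disjoint_sym disjoint_setD andbT.
      by apply: contra yFF; apply: (subsetP XF).
    have c2 : #|y |: (w |: F)| = (2 * p).+2.
      by rewrite !cardsU1 !inE negb_or yw yFF wF (Fam_card FF).
    have bb : bipartition A (y |: (w |: F)) (w |: X).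
      rewrite e; apply: (bipartition_join A_sym) => //.
      - move=> a c /setU1P[->|aX] /setU1P[->|cX].
        + by rewrite A_irr.
        + exact: wX.
        + by rewrite A_sym wX.
        + exact: (bipartition_indep bF).
      - move=> a c /setU1P[->|aY] /setU1P[->|cY].
        + by rewrite A_irr.
        + exact: yY.
        + by rewrite A_sym yY.
        + exact: (bipartition_coindep bF).
      - move=> a c /setU1P[->|aX] /setU1P[->|cY].
        + by rewrite A_sym yX // setU11.
        + exact: wY.
        + have [->|av] := eqVneq a v; first by rewrite A_sym.
          by rewrite A_sym yX // !inE av aX orbT.
        + exact: (bipartition_edge bF).
    apply: (no_even_bip c2 bb).
    + by rewrite cardsU1 wX' /= oX.
    + by rewrite cardsU1 wX'.
    + apply/card_gt0P; exists y; rewrite !inE negb_or yw eqxx andbT /=.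
      by apply: contra yFF; apply: (subsetP XF).
  - by move=> x xX xv; apply: yX; rewrite !inE xv xX orbT.
have /fin_all_exists[y yP] := ex.
exists (yA |: [set y v | v in X]).
have nonadj z : z \in yA |: [set y v | v in X] -> z = yA \/ exists2 v, v \in X & z = y v.
  by move=> /setU1P[->|/imsetP[v vX ->]]; [left|right; exists v].
split.
- rewrite cardsU1 card_in_imset; last first.
    move=> v v' vX v'X e; apply/eqP/negPn/negP => vv'.
    have [_ _ _ n _] := yP _ vX; have [_ _ _ _ /(_ _ vX vv')] := yP _ v'X.
    by rewrite -e (negbTE n).
  suff -> : yA \notin [set y v | v in X] by [].
  apply/imsetP=> -[v vX e]; have [_ _ _ n _] := yP _ vX.
  by rewrite -e yAX in n.
- apply/subsetP => z /nonadj[->|[v vX ->]]; first exact: inW FyA (setU11 _ _).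
  by have [] := yP _ vX.
- move=> z /nonadj[->|[v vX ->]]; last by have [] := yP _ vX.
  by rewrite inE (negbTE yAF) andbF.
- move=> z c /nonadj[->|[v vX ->]] cY; first exact: yAY.
  by have [_ _ h _ _] := yP _ vX; apply: h.
- move=> z /nonadj[->|[v vX ->]].
    rewrite (_ : [set x in X | _] = set0) ?cards0 //.
    by apply/setP=> x; rewrite !inE; apply/negP=> /andP[xX]; rewrite yAX.
  have [_ _ _ _ h] := yP _ vX.
  rewrite -(cards1 v); apply: subset_leq_card; apply/subsetP => x.
  rewrite !inE => /andP[xX]; apply: contraR => xv; exact: h.
Qed.

(** Applying [far_vertices] to both parts X and Y of F gives P and Q. The sets Y, P, X, Q are
    pairwise disjoint, of total size 2(|X| + |Y|) + 2 with |X| + |Y| = 2p. *)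
Lemma card_support_ge F : (1 < p)%N -> Fam F -> (4 * p + 2 <= #|W|)%N.
Proof.
move=> p1 FF; have /existsP[X /and3P[bF oX oY]] := Fam_odd FF.
have [P [cP PW PY PYA PX]] := far_vertices FF bF oX oY.
have [|Q] := far_vertices FF (bipartitionC bF) oY.
  by rewrite bipartition_setDK.
rewrite bipartition_setDK // => -[cQ QW QX QXA QY].
have [XF _] := bipartitionP _ _ _ bF.
set Y := F :\: X in oY PY PYA QY cQ.
have cF : (#|X| + #|Y| = 2 * p)%N.
  by rewrite -(Fam_card FF) -(cardsID X F) (setIidPr XF).
have [x0 x0X] : exists y, y \in X.
  by apply/set0Pn; apply: contraTneq oX => ->; rewrite cards0.
have [y0 y0Y] : exists y, y \in Y.
  by apply/set0Pn; apply: contraTneq oY => ->; rewrite cards0.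
have dPQ : [disjoint Y :|: P & X :|: Q].
  rewrite -setI_eq0; apply/eqP/setP=> t; rewrite [RHS]inE; apply/negP.
  rewrite inE => /andP[/setUP[tY|tP] /setUP[tX|tQ]].
  - by rewrite (disjointFr (disjoint_setD F X) tX) in tY.
  - by move: (QXA _ _ tQ x0X); rewrite A_sym (bipartition_edge bF).
  - by move: (PYA _ _ tP y0Y); rewrite (bipartition_edge bF).
  (* A common vertex of P and Q would be nonadjacent to all of X and Y, yet to at most one vertex of
     each; then 2p is at most 2, contrary to p > 1. *)
  - have := PX _ tP; have := QY _ tQ.
    rewrite (_ : [set x in Y | _] = Y); last first.
      by apply/setP=> x; rewrite inE; case xY: (x \in Y) => //=; apply: PYA.
    rewrite (_ : [set x in X | _] = X); last first.
      by apply/setP=> x; rewrite inE; case xX: (x \in X) => //=; apply: QXA.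
    lia.
have -> : (4 * p + 2 = #|(Y :|: P) :|: (X :|: Q)|)%N.
  rewrite cardsU (eqP (_ : _ :&: _ == set0)); last by rewrite setI_eq0.
  rewrite cards0 !cardsU (eqP (_ : Y :&: P == set0)); last first.
    rewrite setI_eq0; apply/pred0P => t /=; apply/negP => /andP[tY tP].
    by have := PY _ tP; rewrite tY.
  rewrite (eqP (_ : X :&: Q == set0)); last first.
    rewrite setI_eq0; apply/pred0P => t /=; apply/negP => /andP[tX tQ].
    by have := QX _ tQ; rewrite tX.
  by rewrite cards0 cP cQ; lia.
apply: subset_leq_card; rewrite !subUset PW QW !andbT.
by apply/andP; split; apply: subset_trans (Fam_sub FF); rewrite ?subsetDl.
Qed.

End Support.

(** * Cycles carried by even bipartite graphs and by crowns *)

Definition simplex (K : fieldType) (n : nat) (S : {set 'I_n}) :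
    {ffun {set 'I_n} -> K} :=
  [ffun T => (T == S)%:R].

Section Cycles.
Variables (K : fieldType) (n : nat) (A : rel 'I_n).
Hypotheses (A_sym : forall x y, A x y = A y x) (A_irr : irreflexive A).
Implicit Types (F W X Y S : {set 'I_n}) (f : {ffun {set 'I_n} -> K}).

Lemma bd_simplex S k : k \in S ->
  bd (simplex K S) (S :\ k) = (-1) ^+ inversions k (S :\ k).
Proof.
move=> kS; rewrite ffunE (bigD1 k) ?setD11 //= big1 => [|l /andP[lS lk]].
  by rewrite ffunE setD1K // eqxx mulr1 addr0.
rewrite ffunE; case: eqP => [/setP/(_ k)|]; last by rewrite mulr0.
by rewrite !inE eqxx kS eq_sym (negbTE lk).
Qed.

Lemma bd_simplex_neq0 S F : bd (simplex K S) F != 0 ->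
  exists2 k, k \in S & F = S :\ k.
Proof.
move=> /bd_neq0[k kF]; rewrite ffunE; case: (_ =P S) => [e _|]; last by rewrite eqxx.
by exists k; rewrite -e ?setU11 ?setU1K.
Qed.

Lemma even_bip_cycle W X : bipartition A W X -> ~~ odd #|X| ->
  ~~ odd #|W :\: X| -> (0 < #|X|)%N -> (0 < #|W :\: X|)%N ->
  exists g : {ffun {set 'I_n} -> K}, [/\ bd g = 0, exists F, g F != 0 &
    forall F, g F != 0 -> [/\ F \subset W, #|F|.+2 = #|W| & odd_bip A F]].
Proof.
move=> bW eX eY /card_gt0P[x xX] /card_gt0P[y yY].
have [XW _] := bipartitionP _ _ _ bW.
(* [bd h] is, up to sign, the join of the boundaries of X and of W - X. *)
pose h : {ffun {set 'I_n} -> K} :=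
  [ffun T : {set 'I_n} => if X \subset T then bd (simplex K W) T else 0].
exists (bd h); split; first exact: bd_bd.
- exists (W :\ y :\ x).
  have xW : x \in W :\ y.
    rewrite !inE (subsetP XW) // andbT; apply: contraTneq yY => <-.
    by rewrite inE xX.
  have yW : y \in W by move: yY; rewrite inE => /andP[].
  have yX : y \notin X by move: yY; rewrite inE => /andP[].
  rewrite ffunE (bigD1 x) ?setD11 //= big1 ?addr0 => [|k /andP[kF kx]].
    rewrite setD1K // ffunE subsetD1 XW yX bd_simplex //.
    by rewrite mulf_neq0 ?signr_eq0.
  rewrite ffunE; case: ifP => [/subsetP/(_ _ xX)|]; last by rewrite mulr0.
  by rewrite !inE eqxx eq_sym (negbTE kx).
move=> F hF.
(* At a set containing X, [bd h] equals the iterated boundary of the simplex W, hence vanishes.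
   Every surviving face therefore omits one vertex of X and one of W - X. *)
have XF : ~~ (X \subset F).
  apply: contra hF => XF; have /ffunP/(_ F) := bd_bd (simplex K W).
  rewrite [RHS]ffunE [LHS]ffunE => e; rewrite ffunE; apply/eqP.
  rewrite -[RHS]e; apply: eq_bigr => k _.
  by rewrite [h _]ffunE (subset_trans XF) // subsetUr.
have [k kF] := bd_neq0 hF.
rewrite ffunE; case: ifP => [XkF|]; last by rewrite eqxx.
move=> /bd_simplex_neq0[l lW e].
have lX : l \notin X.
  by apply/negP=> /(subsetP XkF); rewrite e setD11.
have kX : k \in X.
  apply: contraR XF => kX; apply/subsetP => z zX.
  have := subsetP XkF _ zX => /setU1P[zk|//].
  by rewrite zk in zX; rewrite zX in kX.
have FE : F = (X :\ k) :|: (W :\: X :\ l).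
  rewrite -(setU1K kF) e; apply/setP=> z; rewrite !inE.
  have [zX|zX] := boolP (z \in X); rewrite /= ?andbF ?orbF ?(subsetP XW _ zX) ?andbT.
    suff -> : z != l by rewrite andbT.
    by apply: contraNneq lX => <-.
  suff -> : z != k by [].
  by apply: contraNneq zX => ->.
have FW : F \subset W.
  by rewrite -(setU1K kF) e; apply: subset_trans (subsetDl _ _) (subsetDl _ _).
split=> //.
  by rewrite (cardsD1 l W) lW -e cardsU1 kF.
have lY : l \in W :\: X by rewrite inE lX.
rewrite FE; apply: (odd_bip_join A_sym).
- apply: disjointWl (subsetDl _ _) _; apply: disjointWr (subsetDl _ _) _.
  exact: disjoint_setD.
- by move=> a b /setD1P[_ aX] /setD1P[_ bX]; apply: (bipartition_indep bW).
- by move=> a b /setD1P[_ aX] /setD1P[_ bX]; apply: (bipartition_coindep bW).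
- by move=> a b /setD1P[_ aX] /setD1P[_ bX]; apply: (bipartition_edge bW).
- by move: eX; rewrite (cardsD1 k) kX /= negbK.
- by move: eY; rewrite (cardsD1 l) lY /= negbK.
Qed.

(** The chain is built from boundaries, so it is automatically a cycle. Once the faces V - v_i have
    cancelled, only stars remain, with centre u_i and leaves V - v_i - v_j; the number m - 2 of
    leaves is odd. *)
Lemma crown_cycle m (f : 'I_m + 'I_m -> 'I_n) : injective f -> odd m ->
  (2 < m)%N -> (forall x y, A (f x) (f y) = crown x y) ->
  exists g : {ffun {set 'I_n} -> K}, [/\ bd g = 0, exists F, g F != 0 &
    forall F, g F != 0 ->
      [/\ F \subset [set f x | x in predT], #|F|.+1 = m & odd_bip A F]].
Proof.
move=> fI om m2 fA.
pose u i := f (inl i); pose v i := f (inr i).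
pose V := [set v i | i in predT].
have uI i j : u i = u j -> i = j by move=> /fI[].
have vI i j : v i = v j -> i = j by move=> /fI[].
have uV i : u i \notin V by apply/imsetP => -[j _ /fI].
have vV i : v i \in V by apply/imsetP; exists i.
have cV : #|V| = m by rewrite card_imset // card_ord.
pose V' i := V :\ v i.
have uV' i j : u i \notin V' j by rewrite inE (negbTE (uV i)) andbF.
(* The sign [c i] cancels the face V - v_i between V and u_i + V - v_i. *)
pose c i : K :=
  - ((-1) ^+ inversions (v i) (V' i) * (-1) ^+ inversions (u i) (V' i)).
pose g : {ffun {set 'I_n} -> K} := bd (simplex K V) +
  \sum_i [ffun T => c i * bd (simplex K (u i |: V' i)) T].
have gE F : g F = bd (simplex K V) F + \sum_i c i * bd (simplex K (u i |: V' i)) F.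
  by rewrite /g ffunE sum_ffunE; congr (_ + _); apply: eq_bigr => i _; rewrite ffunE.
have c0 i : c i != 0 by rewrite oppr_eq0 mulf_neq0 ?signr_eq0.
have g1 i : g (V' i) = 0.
  rewrite gE bd_simplex // (bigD1 i) //= big1 ?addr0 => [|j ji].
    have := bd_simplex (setU11 (u i) (V' i)); rewrite setU1K // => ->.
    rewrite /c mulNr -mulrA sqr_sign mulr1.
    by rewrite subrr.
  apply/eqP; rewrite mulf_eq0; apply/orP; right; apply/negPn/negP.
  move=> /bd_simplex_neq0[x _] /setP/(_ (v j)).
  rewrite !inE vV andbT eqxx /= orbF (inj_eq vI) ji /=.
  case: (v j =P u j) => [/fI //|]; by rewrite andbF.
have g2 i j : i != j -> g (u i |: V' i :\ v j) != 0.
  move=> ij; rewrite gE (_ : bd _ _ = 0) ?add0r; last first.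
    apply/eqP/negPn/negP => /bd_simplex_neq0[x _] /setP/(_ (u i)).
    by rewrite !inE eqxx (negbTE (uV i)) !andbF.
  rewrite (bigD1 i) //= big1 ?addr0 => [|k ki].
    rewrite mulf_neq0 //.
    have -> : u i |: V' i :\ v j = (u i |: V' i) :\ v j.
      apply/setP=> x; rewrite !inE; case: eqP => [->|]; rewrite ?andbT //=.
      by case: eqP => // /fI.
    rewrite bd_simplex ?signr_eq0 // !inE vV (inj_eq vI) [j == i]eq_sym ij.
    by rewrite orbT.
  apply/eqP; rewrite mulf_eq0; apply/orP; right; apply/negPn/negP.
  move=> /bd_simplex_neq0[x _] /setP/(_ (u i)).
  rewrite !inE eqxx (negbTE (uV i)) (inj_eq uI) [i == k]eq_sym (negbTE ki) /=.
  by rewrite !andbF.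
exists g; split.
- rewrite bdD bd_bd add0r bd_sum big1 // => i _.
  by rewrite bd_scale bd_bd; apply/ffunP=> T; rewrite !ffunE mulr0.
- have m0 : (0 < m)%N by lia.
  have m1 : (1 < m)%N by lia.
  by exists (u (Ordinal m0) |: V' (Ordinal m0) :\ v (Ordinal m1)); apply: g2.
move=> F gF.
suff [i [j [ij FE]]] : exists i j, i != j /\ F = [set u i] :|: (V' i :\ v j).
  have vj : v j \in V' i by rewrite !inE vV (inj_eq vI) eq_sym ij.
  have ci : #|V' i :\ v j|.+2 = m.
    by rewrite -cV (cardsD1 (v i) V) vV (cardsD1 (v j) (V :\ v i)) vj.
  have ui : u i \notin V' i :\ v j by rewrite !inE (negbTE (uV i)) !andbF.
  split.
  - rewrite FE subUset sub1set; apply/andP; split; first by apply/imsetP; exists (inl i).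
    apply/subsetP=> x /setD1P[_ /setD1P[_ /imsetP[k _ ->]]].
    by apply/imsetP; exists (inr k).
  - by rewrite FE cardsU1 ui add1n.
  - rewrite FE; apply: (odd_bip_join A_sym).
    + by rewrite disjoints1.
    + by move=> a b /set1P-> /set1P->; rewrite A_irr.
    + move=> a b /setD1P[_ /setD1P[_ /imsetP[k _ ->]]].
      by move=> /setD1P[_ /setD1P[_ /imsetP[l _ ->]]]; rewrite fA.
    + move=> a b /set1P-> /setD1P[_ /setD1P[]] h /imsetP[k _ bE].
      by rewrite bE fA /=; apply: contraNneq h => ->; rewrite bE.
    + by rewrite cards1.
    + by move: om; rewrite -ci /= negbK.
have gV i : F <> V' i by move=> e; rewrite e g1 eqxx in gF.
have /orP[|] : (bd (simplex K V) F != 0) ||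
    [exists i, bd (simplex K (u i |: V' i)) F != 0].
- apply: contraR gF; rewrite negb_or negb_exists negbK => /andP[/eqP e /forallP h].
  rewrite gE e add0r big1 // => i _.
  by move/(_ i)/negPn/eqP: h => ->; rewrite mulr0.
- by move=> /bd_simplex_neq0[x /imsetP[i _ ->]] /gV.
move=> /existsP[i /bd_simplex_neq0[x /setU1P[->|]]].
  by rewrite setU1K // => /gV.
move=> /setD1P[xi /imsetP[j _ xE]] FE; rewrite xE in xi FE.
exists i, j; split; first by apply: contraNneq xi => ->.
rewrite FE; apply/setP=> y; rewrite !inE; case: (y =P v j) => [->|]; rewrite ?andbT //=.
by case: eqP => // /fI.
Qed.

End Cycles.

(** * The squarefree power of the Stanley-Reisner ideal *)

(** A monomial ideal consists of the polynomials whose exponents all lie in some upward closed set,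
    so ideal membership becomes a condition on exponents. *)
Definition supp_in (K : fieldType) (n : nat) (Q : 'X_{1..n} -> Prop)
    (f : {mpoly K[n]}) : Prop :=
  forall m, f@_m != 0 -> Q m.

Definition edge_monomial (n : nat) (s : seq ('I_n * 'I_n)) : 'X_{1..n} :=
  (\big[mnm_add/mnm0]_(e <- s) (U_(e.1) + U_(e.2)))%MM.

Definition edge_multiple (n : nat) (B : rel 'I_n) (k : nat) (m : 'X_{1..n}) :
    Prop :=
  exists s, [/\ size s = k, all (fun e => B e.1 e.2) s &
    (edge_monomial s <= m)%MM].

(** Divisibility by a generator of the squarefree power, the generators being recognised through
    [co_matchable_or_odd_bip] as the 2p-sets that are not odd. *)
Definition in_power (n : nat) (A : rel 'I_n) (p : nat) (m : 'X_{1..n}) : bool :=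
  [exists W : {set 'I_n}, [&& (mesym1 W <= m)%MM, #|W| == (2 * p)%N &
     ~~ odd_bip A W]].

Section Ideals.
Variables (K : fieldType) (n : nat).
Implicit Types (G I : {mpoly K[n]} -> Prop) (f g : {mpoly K[n]})
  (m : 'X_{1..n}) (W : {set 'I_n}).

Lemma ideal_gen_ind G (P : {mpoly K[n]} -> Prop) :
  P 0 -> (forall f g, P f -> P g -> P (f + g)) ->
  (forall c g, G g -> P (c * g)) -> forall f, ideal_gen G f -> P f.
Proof.
move=> P0 PD PM f [s sG ->]; rewrite big_seq.
by apply: big_ind => // c /sG; apply: PM.
Qed.

Lemma ideal_gen0 G : ideal_gen G 0.
Proof. by exists [::]; rewrite ?big_nil. Qed.

Lemma ideal_genD G f g : ideal_gen G f -> ideal_gen G g -> ideal_gen G (f + g).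
Proof.
move=> [s sG ->] [t tG ->]; exists (s ++ t); last by rewrite big_cat.
by move=> c; rewrite mem_cat => /orP[/sG|/tG].
Qed.

Lemma ideal_gen_mull G c g : G g -> ideal_gen G (c * g).
Proof. by move=> Gg; exists [:: (c, g)]; rewrite ?big_seq1 // => x /predU1P[->|]. Qed.

Lemma ideal_gen_incl G g : G g -> ideal_gen G g.
Proof. by rewrite -[g in ideal_gen _ g]mul1r; apply: ideal_gen_mull. Qed.

Definition upward (Q : 'X_{1..n} -> Prop) := forall m m', Q m -> Q (m' + m)%MM.

Lemma supp_inM (Q1 Q2 Q3 : 'X_{1..n} -> Prop) f g :
  (forall m1 m2, Q1 m1 -> Q2 m2 -> Q3 (m1 + m2)%MM) ->
  supp_in Q1 f -> supp_in Q2 g -> supp_in Q3 (f * g).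
Proof. by move=> Q sf sg m /mcoeffM_neq0[m1 [m2 [/sf h1 /sg h2 ->]]]; apply: Q. Qed.

Lemma supp_in_ideal G Q : upward Q -> (forall g, G g -> supp_in Q g) ->
  forall f, ideal_gen G f -> supp_in Q f.
Proof.
move=> uQ GQ; apply: ideal_gen_ind.
- by move=> m; rewrite mcoeff0 eqxx.
- move=> f g Pf Pg m; rewrite mcoeffD => h.
  have [f0|] := eqVneq f@_m 0; last exact: Pf.
  by apply: Pg; move: h; rewrite f0 add0r.
- move=> c g /GQ Qg; apply: (@supp_inM (fun _ => True) Q) Qg => // m1 m2 _.
  exact: uQ.
Qed.

Lemma prod_mesym1 W : \prod_(i in W) 'X_i = 'X_[mesym1 W] :> {mpoly K[n]}.
Proof.
rewrite mpolyXE_id big_mkcond /=; apply: eq_bigr => i _.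
by rewrite mesym1_mem; case: (i \in W).
Qed.

Lemma supp_in_X Q m : supp_in Q ('X_[m] : {mpoly K[n]}) <-> Q m.
Proof.
split=> [|Qm m']; first by apply; rewrite mcoeffX eqxx oner_eq0.
by rewrite mcoeffX; case: (m =P m') => [<-|_] //; rewrite eqxx.
Qed.

Lemma mesym1_leS W W' : (mesym1 W <= mesym1 W')%MM = (W \subset W').
Proof.
apply/mesym1_le/subsetP => h i /h; rewrite mesym1_mem; by case: (i \in W').
Qed.

Lemma mnm_le_trans m1 m2 m3 : (m1 <= m2)%MM -> (m2 <= m3)%MM -> (m1 <= m3)%MM.
Proof.
move=> /mnm_lepP h1 /mnm_lepP h2; apply/mnm_lepP => i.
exact: leq_trans (h1 i) (h2 i).
Qed.

Lemma mnm_le_deg m m' : (m' <= m)%MM -> (mdeg m <= mdeg m')%N -> m' = m.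
Proof.
move=> /submK e h.
have /eqP : mdeg (m - m') = 0%N by have := congr1 mdeg e; rewrite mdegD; lia.
by rewrite mdeg_eq0 => /eqP z; rewrite -e z add0m.
Qed.

Lemma mdeg_edge_monomial (s : seq ('I_n * 'I_n)) :
  mdeg (edge_monomial s) = (2 * size s)%N.
Proof.
rewrite /edge_monomial; elim: s => [|e s IH]; first by rewrite big_nil mdeg0.
by rewrite big_cons !mdegD !mdeg1 IH /=; lia.
Qed.

Variables (D : {set {set 'I_n}}).
Hypotheses (D_complex : simplicial_complex D) (D_dim1 : has_dim D 1)
  (D_flag : flag K D).
Let A := skeleton1 D.
Let B := co_skeleton1 D.

Lemma skeleton1_sym x y : skeleton1 D x y = skeleton1 D y x.
Proof. by rewrite /skeleton1 eq_sym setUC. Qed.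

Lemma skeleton1_irr : irreflexive (skeleton1 D).
Proof. by move=> x; rewrite /skeleton1 eqxx. Qed.

Lemma set0_in_complex : set0 \in D.
Proof.
apply/negPn/negP => h; have := D_dim1; rewrite /has_dim big_pred0 // => F.
by apply: contraNF h; apply: D_complex.1; apply: sub0set.
Qed.

Lemma stanley_reisner_supp f : stanley_reisner D f ->
  supp_in (fun m => exists2 W, W \notin D & (mesym1 W <= m)%MM) f.
Proof.
move: f; apply: supp_in_ideal.
  move=> m m' [W WD h]; exists W => //.
  exact: mnm_le_trans h (lem_addl _ _).
move=> g [W WD ->]; rewrite prod_mesym1; apply/supp_in_X; exists W => //.
by rewrite mesym1_leS.
Qed.

(** Some monomial of a degree 2 generator divides the monomial of W, and it is itself divisible by
    the monomial of a nonface. That nonface has at most two vertices, and it is neither empty nor a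
    single vertex. *)
Lemma nonface_nonedge W : W \notin D ->
  exists x y, [/\ x \in W, y \in W & co_skeleton1 D x y].
Proof.
move=> WD; have [G Ghom GI] := D_flag.
have WI : ideal_gen G 'X_[mesym1 W].
  by apply/GI; apply: ideal_gen_incl; exists W; rewrite ?prod_mesym1.
pose Q m := exists g m', [/\ G g, g@_m' != 0 & (m' <= m)%MM].
have uQ : upward Q.
  move=> m m' [g [m2 [Gg gm h]]]; exists g, m2; split=> //.
  exact: mnm_le_trans h (lem_addl _ _).
have GQ g : G g -> supp_in Q g.
  by move=> Gg m gm; exists g, m; split=> //; apply/mnm_lepP.
have [g [m [Gg gm mW]]] := (supp_in_X _ _).1 (supp_in_ideal uQ GQ WI).
have [W' W'D W'm] : exists2 W', W' \notin D & (mesym1 W' <= m)%MM.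
  by apply: (stanley_reisner_supp _ gm); apply/GI/ideal_gen_incl.
have dm : mdeg m = 2%N by apply: (dhomogP _ _ _ (Ghom _ Gg)); rewrite mcoeff_msupp.
have c2 : (#|W'| <= 2)%N.
  by rewrite -mdeg_mesym1 -dm -(submK W'm) mdegD leq_addl.
have W'W : W' \subset W by rewrite -mesym1_leS (mnm_le_trans W'm).
have W'0 : W' != set0 by apply: contraNneq W'D => ->; exact: set0_in_complex.
have W'1 : #|W'| != 1%N.
  by apply: contraNneq W'D => /eqP/cards1P[x ->]; apply: D_complex.2.
have /cards2P[x [y [xy W'E]]] : #|W'| == 2%N.
  by move: c2 W'1; rewrite -cards_eq0 in W'0; move: W'0; case: #|W'| => [|[|[|]]].
exists x, y; rewrite /co_skeleton1 xy -W'E W'D; split=> //;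
by apply: (subsetP W'W); rewrite W'E !inE eqxx ?orbT.
Qed.

(** By dimension the triangle is not a face, so flagness yields a missing edge among its three
    sides. *)
Lemma skeleton1_triangle_free x y z :
  skeleton1 D x y -> skeleton1 D y z -> skeleton1 D x z = false.
Proof.
move=> /andP[xy xyD] /andP[yz yzD]; apply/negP => /andP[xz xzD].
have : [set x; y; z] \notin D.
  apply/negP => TD.
  have := @leq_bigmax_cond _ (mem D) (fun F : {set 'I_n} => #|F|) _ TD.
  rewrite D_dim1 setUC cardsU1 !inE cards2 xy negb_or.
  by rewrite [z == x]eq_sym xz [z == y]eq_sym yz.
move=> /nonface_nonedge[a [b [aT bT /andP[ab abD]]]].
have sub s : s \in D -> [set a; b] \subset s -> False.
  by move=> sD h; move/negP: abD; apply; apply: D_complex.1 sD.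
move: aT bT ab; rewrite !inE -!orbA.
case/or3P=> /eqP ea; case/or3P=> /eqP eb; rewrite ea eb ?eqxx // => _;
  [apply: (sub _ xyD)|apply: (sub _ xzD)|apply: (sub _ xyD)|
   apply: (sub _ yzD)|apply: (sub _ xzD)|apply: (sub _ yzD)]; by rewrite ea eb subUset !sub1set !inE !eqxx ?orbT.
Qed.

Lemma edge_multipleM k1 k2 m1 m2 : edge_multiple B k1 m1 ->
  edge_multiple B k2 m2 -> edge_multiple B (k1 + k2) (m1 + m2)%MM.
Proof.
move=> [s1 [<- B1 h1]] [s2 [<- B2 h2]]; exists (s1 ++ s2).
rewrite size_cat all_cat B1 B2; split=> //.
rewrite /edge_monomial big_cat /=; apply/mnm_lepP=> i; rewrite !mnmDE.
by apply: leq_add; [move/mnm_lepP: h1|move/mnm_lepP: h2]; apply.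
Qed.

Lemma upward_edge_multiple k : upward (edge_multiple B k).
Proof.
move=> m m' [s [ss Bs h]]; exists s; split=> //.
exact: mnm_le_trans h (lem_addl _ _).
Qed.

Lemma stanley_reisner_edges f : stanley_reisner D f ->
  supp_in (edge_multiple B 1) f.
Proof.
move=> /stanley_reisner_supp h m /h[W /nonface_nonedge[x [y [xW yW xy]]] Wm].
exists [:: (x, y)]; split; rewrite /= ?andbT //.
apply: mnm_le_trans Wm; rewrite /edge_monomial big_seq1 /=.
apply/mnm_lepP=> i; rewrite mnmDE !mnm1E mesym1_mem.
have xy' : x != y by case/andP: xy.
case: (x =P i) => [<-|_]; first by rewrite xW eq_sym (negbTE xy').
by case: (y =P i) => [<-|_] //; rewrite yW.
Qed.

Lemma ideal_pow_edges p f : ideal_pow (stanley_reisner D) p f ->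
  supp_in (edge_multiple B p) f.
Proof.
move: f; apply: supp_in_ideal; first exact: upward_edge_multiple.
move=> g [s [<- sI ->]]; elim: s sI => [|h s IH] sI.
  rewrite big_nil => m _; exists [::]; split=> //.
  by rewrite /edge_monomial big_nil; apply/mnm_lepP=> i; rewrite mnm0E.
rewrite big_cons [size _]/= -add1n; apply: (supp_inM (@edge_multipleM _ _)).
  by apply: stanley_reisner_edges; apply: sI; rewrite mem_head.
by apply: IH => x xs; apply: sI; rewrite inE xs orbT.
Qed.

Lemma edge_monomial_pow s : all (fun e => B e.1 e.2) s ->
  ideal_pow (@stanley_reisner K n D) (size s) 'X_[edge_monomial s].
Proof.
move=> Bs; apply: ideal_gen_incl.
exists [seq 'X_(e.1) * 'X_(e.2) | e <- s]; rewrite size_map; split=> //.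
  move=> f /mapP[e es ->]; apply: ideal_gen_incl.
  have /andP[e12 eD] := allP Bs _ es.
  by exists [set e.1; e.2]; rewrite // big_setU1 ?big_set1 ?inE.
rewrite big_map /edge_monomial; elim: s {Bs} => [|e s IH].
  by rewrite !big_nil mpolyX0.
by rewrite !big_cons -IH !mpolyXD.
Qed.

Lemma co_matchable_edges W : co_matchable A W ->
  exists2 s, all (fun e => B e.1 e.2) s & edge_monomial s = mesym1 W.
Proof.
elim=> [|x y {}W xy Axy xW yW _ [s Bs sW]].
  exists [::] => //; rewrite /edge_monomial big_nil.
  by apply/mnmP=> i; rewrite mnm0E mesym1_mem inE.
exists ((x, y) :: s).
  rewrite /= Bs andbT /B /co_skeleton1 xy /=.
  by move: Axy; rewrite /A /skeleton1 xy.
rewrite /edge_monomial big_cons -/(edge_monomial s) sW /=.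
apply/mnmP=> i; rewrite !mnmDE !mnm1E !mesym1_mem !inE.
have [->|ix] := eqVneq i x; first by rewrite eq_sym (negbTE xy) (negbTE xW).
by have [->|iy] := eqVneq i y; rewrite ?(negbTE yW).
Qed.

Lemma edges_co_matchable s : all (fun e => B e.1 e.2) s ->
  squarefree (edge_monomial s) ->
  exists2 W, co_matchable A W & edge_monomial s = mesym1 W.
Proof.
elim: s => [|[x y] s IH] /=.
  exists set0; first exact: CoMatchable0.
  rewrite /edge_monomial big_nil.
  by apply/mnmP=> i; rewrite mnm0E mesym1_mem inE.
move=> /andP[/andP[xy xyD] Bs].
rewrite /edge_monomial big_cons -/(edge_monomial s) /= => sf.
have [//|i|W mW sW] := IH.
  by apply: leq_trans (sf i); rewrite !mnmDE leq_addl.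
have xW : x \notin W.
  have := sf x; rewrite !mnmDE !mnm1E eqxx sW mesym1_mem eq_sym (negbTE xy).
  by case: (x \in W).
have yW : y \notin W.
  have := sf y; rewrite !mnmDE !mnm1E eqxx sW mesym1_mem (negbTE xy).
  by case: (y \in W).
exists (x |: (y |: W)).
  by apply: CoMatchable2 => //; rewrite /A /skeleton1 (negbTE xyD) andbF.
rewrite sW.
apply/mnmP=> i; rewrite !mnmDE !mnm1E !mesym1_mem !inE.
have [->|ix] := eqVneq i x; first by rewrite eq_sym (negbTE xy) (negbTE xW).
by have [->|iy] := eqVneq i y; rewrite ?(negbTE yW).
Qed.

Lemma in_power_upward p : upward (in_power A p).
Proof.
move=> m m' /existsP[W /and3P[h c o]]; apply/existsP; exists W.
by rewrite c o !andbT (mnm_le_trans h (lem_addl _ _)).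
Qed.

(** A minimal generator of the power equals the product of p edges below it, and squarefreeness
    makes these edges a matching. Conversely a product over a p-matching is minimal because every
    monomial in the power has degree at least 2p. *)
Lemma sqfree_powerP p f : sqfree_power (@stanley_reisner K n D) p f <->
  supp_in (in_power A p) f.
Proof.
split.
  move: f; apply: supp_in_ideal; first exact: in_power_upward.
  move=> g [m [[Im mmin] sf ->]]; apply/supp_in_X.
  have [s [ss Bs sm]] := (supp_in_X _ _).1 (ideal_pow_edges Im).
  have e : edge_monomial s = m by apply: mmin => //; rewrite -ss; apply: edge_monomial_pow.
  have [|W mW sW] := edges_co_matchable Bs; first by rewrite e.
  apply/existsP; exists W; rewrite -e sW mesym1_leS subxx -mdeg_mesym1 -sW.
  rewrite mdeg_edge_monomial ss eqxx /=.
  by apply/negP => /odd_bip_not_co_matchable.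
move=> sf; rewrite [f]mpolyE big_seq.
apply: big_ind; [exact: ideal_gen0|exact: ideal_genD|].
move=> m; rewrite mcoeff_msupp => /sf/existsP[W /and3P[Wm /eqP Wc Wo]].
rewrite -(submK Wm) mpolyXD scalerAl; apply: ideal_gen_mull.
exists (mesym1 W); split=> //; last by move=> i; rewrite mesym1_mem leq_b1.
have We : ~~ odd #|W| by rewrite Wc mul2n odd_double.
have [mW|] := co_matchable_or_odd_bip skeleton1_sym skeleton1_irr
  skeleton1_triangle_free We; last by rewrite (negbTE Wo).
have [s Bs sW] := co_matchable_edges mW.
have ss : size s = p.
  by have := mdeg_edge_monomial s; rewrite sW mdeg_mesym1 Wc; lia.
split; first by rewrite -sW -ss; apply: edge_monomial_pow.
move=> m' /ideal_pow_edges/supp_in_X[s' [ss' _ h]] m'W.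
apply: (mnm_le_deg m'W); rewrite mdeg_mesym1 Wc -ss' -mdeg_edge_monomial.
by rewrite -(submK h) mdegD leq_addl.
Qed.

End Ideals.

(** * Betti numbers and cycles of odd sets *)

(* Alexander duality inside W: up to sign, it turns [bd] into [cobd]. *)
Definition star (K : fieldType) (n : nat) (W : {set 'I_n})
    (g : {ffun {set 'I_n} -> K}) : {ffun {set 'I_n} -> K} :=
  [ffun T : {set 'I_n} => if T \subset W then
     (-1) ^+ (\sum_(k in W :\: T) inversions k W) * g (W :\: T) else 0].

(* The resolution F prolonged by the free module S: F_i sits in position i + 1,
   and the augmentation is the first differential. *)
Definition sub_rank (K : fieldType) (n : nat) (F : graded_free K n)
    (i : nat) : nat :=
  if i is i'.+1 then grank F i' else 1.

Definition sub_deg (K : fieldType) (n : nat) (F : graded_free K n) (i : nat) :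
    'I_(sub_rank F i) -> nat :=
  match i with 0 => fun=> 0 | i'.+1 => @gdeg K n F i' end.

Definition sub_diff (K : fieldType) (n : nat) (F : graded_free K n) (i : nat) :
    'M[{mpoly K[n]}]_(sub_rank F i.+1, sub_rank F i) :=
  match i with 0 => gaug F | i'.+1 => gdiff F i' end.

(** * Alexander duality and a dual criterion for solving boundary equations *)

Section Duality.
Variables (K : fieldType) (n : nat).
Implicit Types (E F S T W : {set 'I_n}) (f g : {ffun {set 'I_n} -> K}).

Lemma cobd_star W g T : (forall F, g F != 0 -> F \subset W) -> T \subset W ->
  cobd (star W g) T =
  (-1) ^+ (\sum_(k in W :\: T) inversions k W) * bd g (W :\: T).
Proof.
move=> gW TW; rewrite !ffunE mulr_sumr [RHS](bigID (fun k => k \in T)) /=.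
rewrite [X in _ = _ + X]big1 ?addr0 => [|k /andP[kE kT]]; last first.
  suff -> : g (k |: W :\: T) = 0 by rewrite !mulr0.
  apply/eqP/negPn/negP => /gW/subsetP/(_ k (setU11 _ _)) kW.
  by move: kE; rewrite inE kT kW.
apply: eq_big => [k|k kT].
  by rewrite inE; case: (k \in T); rewrite ?andbF.
have kW := subsetP TW _ kT.
have kE : k \notin W :\: T by rewrite inE kT.
rewrite ffunE (subset_trans (subsetDl _ _) TW).
have -> : W :\: (T :\ k) = k |: W :\: T.
  apply/setP=> x; rewrite !inE negb_and negbK.
  by case: eqP => [->|]; rewrite ?kW ?andbT.
rewrite big_setU1 //= !mulrA -!exprD; congr (_ * _).
(* The vertices of W below k lie in W - T or in T - k; the second count occurs twice in the total
   sign and drops out. *)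
have -> : inversions k W = (inversions k (W :\: T) + inversions k (T :\ k))%N.
  rewrite /inversions -cardsUI [X in (_ = _ + X)%N]eq_card0 ?addn0.
    apply: eq_card => x; rewrite !inE.
    have [->|_] := eqVneq x k; first by rewrite ltnn !andbF.
    by have [/(subsetP TW)->|_] := boolP (x \in T); rewrite /= ?orbF.
  by move=> x; rewrite !inE; case: (x \in T); rewrite ?andbF.
set a := inversions k (T :\ k); set b := inversions k (W :\: T).
set s := (\sum_(i in _) _)%N.
have -> : (a + (b + a + s) = a.*2 + (s + b))%N by rewrite -addnn; lia.
by rewrite exprD -mul2n exprM sqrrN expr1n expr1n mul1r.
Qed.

Lemma cobd_simplex f T :
  cobd f T = \sum_(S : {set 'I_n}) bd (simplex K T) S * f S.
Proof.
rewrite bd_cobd (bigD1 T) //= big1 ?addr0 => [|S ST].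
  by rewrite [simplex _ _ _]ffunE eqxx mul1r.
by rewrite [simplex _ _ _]ffunE (negbTE ST) mul0r.
Qed.

Lemma bd_simplex_sum f T :
  bd f T = \sum_(S : {set 'I_n}) f S * bd (simplex K S) T.
Proof.
transitivity (\sum_(S : {set 'I_n}) bd f S * simplex K T S).
  rewrite (bigD1 T) //= big1 ?addr0 => [|S ST].
    by rewrite [simplex _ _ _]ffunE eqxx mulr1.
  by rewrite [simplex _ _ _]ffunE (negbTE ST) mulr0.
rewrite bd_cobd; apply: eq_bigr => S _; congr (_ * _).
rewrite cobd_simplex (bigD1 T) //= big1 ?addr0 => [|S' ST].
  by rewrite [simplex _ _ T]ffunE eqxx mulr1.
by rewrite [simplex _ _ S']ffunE (negbTE ST) mulr0.
Qed.

(** Finite-dimensional duality for the block of the matrix of [bd] with rows in X and columns in Y: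
    the block is onto as soon as its transpose, a block of [cobd], is injective. *)
Lemma bd_surjective_on (X Y : pred {set 'I_n}) f :
  (forall y : {ffun {set 'I_n} -> K}, (forall T, y T != 0 -> Y T) ->
     (forall T, X T -> cobd y T = 0) -> y = 0) ->
  exists h : {ffun {set 'I_n} -> K},
    (forall T, h T != 0 -> X T) /\ (forall T, Y T -> bd h T = f T).
Proof.
move=> inj; pose N := #|{: {set 'I_n}}|.
pose M : 'M[K]_N := \matrix_(s, t) if X (enum_val s) && Y (enum_val t)
  then bd (simplex K (enum_val s)) (enum_val t) else 0.
pose f' : 'rV[K]_N := \row_t if Y (enum_val t) then f (enum_val t) else 0.
have reix (G : 'I_N -> K) : \sum_s G s = \sum_T G (enum_rank T).
  by rewrite (reindex _ (onW_bij _ (@enum_rank_bij _))).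
have /submxP[w wE] : (f' <= M)%MS.
  rewrite submxE; apply/eqP/matrixP => i0 t; rewrite mxE [RHS]mxE reix.
  pose y : {ffun {set 'I_n} -> K} :=
    [ffun T => if Y T then cokermx M (enum_rank T) t else 0].
  have y0 : y = 0.
    apply: inj => [T|T XT]; first by rewrite ffunE; case: ifP => //; rewrite eqxx.
    have /matrixP/(_ (enum_rank T) t) := mulmx_coker M.
    rewrite mxE [RHS]mxE reix => e; rewrite cobd_simplex -[RHS]e.
    apply: eq_bigr => S _; rewrite mxE !enum_rankK XT /= [y S]ffunE.
    by case: (Y S); rewrite ?mulr0 ?mul0r.
  apply: big1 => T _; rewrite mxE enum_rankK; case YT: (Y T); last by rewrite mul0r.
  by have /ffunP/(_ T) := y0; rewrite !ffunE YT => ->; rewrite mulr0.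
exists [ffun T => if X T then w 0 (enum_rank T) else 0]; split=> [T|T YT].
  by rewrite ffunE; case: ifP => //; rewrite eqxx.
have /rowP/(_ (enum_rank T)) := wE; rewrite !mxE enum_rankK YT => ->.
rewrite reix bd_simplex_sum; apply: eq_bigr => S _.
rewrite mxE !enum_rankK YT andbT [X in X * _ = _]ffunE.
by case: (X S); rewrite ?mul0r ?mulr0.
Qed.

End Duality.

(** * Betti numbers in degree j + 2p + 1 via cycles supported on odd sets *)

Section Betti.
Variables (K : fieldType) (n p : nat) (A : rel 'I_n).
Hypotheses (A_sym : forall x y, A x y = A y x) (A_irr : irreflexive A).
Hypothesis A_tf : forall x y z, A x y -> A y z -> A x z = false.
Variables (I : {mpoly K[n]} -> Prop) (F : graded_free K n).
Hypothesis F_res : minimal_graded_free_resolution I F.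
Hypothesis I_power : forall f, I f <-> supp_in (in_power A p) f.
Implicit Types (S T W : {set 'I_n}) (g : {ffun {set 'I_n} -> K}).

Definition facet_cycle W g : Prop := bd g = 0 /\
  forall S, g S != 0 -> [/\ S \subset W, #|S| = (2 * p)%N & odd_bip A S].

Lemma sub_hom i a b m :
  (sub_diff F i a b)@_m != 0 -> sub_deg a = (sub_deg b + mdeg m)%N.
Proof.
case: F_res => -[Haug Hdiff] _ _; case: i a b => [|i] a b /=.
  rewrite add0n ord1 -mcoeff_msupp => h.
  by rewrite (dhomogP _ _ _ (Haug a) _ h).
have [->|[d -> Hd]] := Hdiff i a b; first by rewrite mcoeff0 eqxx.
by rewrite -mcoeff_msupp => h; rewrite (dhomogP _ _ _ Hd _ h).
Qed.

Lemma sub_exact i (v : 'rV_(sub_rank F i.+1)) :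
  v *m sub_diff F i = 0 <-> exists w, v = w *m sub_diff F i.+1.
Proof. by case: F_res => _ [_ h0 h] _; case: i v => [|i] v /=. Qed.

Lemma sub_image (v : 'rV_1) : (exists w, v = w *m sub_diff F 0) <-> I (v 0 0).
Proof.
case: F_res => _ [h _ _] _; split=> [[w ->]|/h[w wE]]; first by apply/h; exists w.
by exists w; apply/rowP=> i; rewrite ord1.
Qed.

Lemma betti_eq0 i d : betti F i d = 0 <-> forall a : 'I_(grank F i), gdeg a <> d.
Proof.
split=> [/eqP|h].
  by rewrite cards_eq0 => /eqP/setP h a /eqP; have := h a; rewrite !inE => ->.
apply/eqP; rewrite cards_eq0; apply/eqP/setP => a; rewrite !inE.
by apply/negP => /eqP; apply: h.
Qed.

Lemma in_power_setD W T : #|W :\: T| = (2 * p)%N -> T \subset W ->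
  in_power A p (mesym1 W - mesym1 T) = ~~ odd_bip A (W :\: T).
Proof.
move=> c TW.
have -> : (mesym1 W - mesym1 T = mesym1 (W :\: T))%MM.
  apply/mnmP=> i; rewrite mnmBE !mesym1_mem inE.
  by case: (i \in T); case: (i \in W).
apply/existsP/idP => [[S /and3P[]]|o].
  rewrite mesym1_leS => SW /eqP Sc o.
  have /eqP <- // : S == W :\: T by rewrite eqEcard SW Sc c leqnn.
by exists (W :\: T); rewrite mesym1_leS subxx c eqxx.
Qed.

(* The Koszul boundary of x^S e_(W - S), for a facet S in the support of g, is a
   cycle of J; pairing with the dual of g shows that it is not a boundary. *)
Lemma betti_neq0 j W g : #|W| = (j + 2 * p + 1)%N -> facet_cycle W g -> g <> 0 ->
  betti F j (j + 2 * p + 1) <> 0.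
Proof.
move=> Wc [g0 gs] gn0 /betti_eq0 b0.
have /existsP[S gS] : [exists S, g S != 0].
  apply: contraT; rewrite negb_exists => /forallP h; case: gn0.
  by apply/ffunP=> S; rewrite [RHS]ffunE; apply/eqP/negPn.
have [SW Sc So] := gs _ gS.
have cWS : #|W :\: S| = j.+1 by rewrite cardsD (setIidPr SW) Wc Sc; lia.
pose v : chain K n 1 := [ffun T : {set 'I_n} =>
  if T == W :\: S then const_mx 'X_[mesym1 S] else 0].
have vE a mu T : strand v a mu T != 0 -> T = W :\: S /\ mu = (mesym1 S + mesym1 T)%MM.
  move=> h; have Tmu := strand_supp h; move: h; rewrite ffunE Tmu ffunE.
  case: (T =P _) => [e|_]; last by rewrite mxE mcoeff0 eqxx.
  rewrite mxE mcoeffX.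
  case: (mesym1 S =P _) => [eS _|]; last by rewrite eqxx.
  by rewrite eS submK.
have uE T m : (kz v T 0 0)@_m != 0 ->
    exists2 k, k \notin T & k |: T = W :\: S /\ m = (mesym1 S + U_(k))%MM.
  rewrite coef_strand strand_kz => /bd_neq0[k kT /vE[e me]].
  exists k => //; split=> //; apply/mnmP=> i.
  move/mnmP/(_ i): me; rewrite !mnmDE !mesym1_mem mnm1E !inE.
  case: (eqVneq i k) => [->|_]; first by rewrite (negbTE kT) addn0.
  by rewrite addn0 => /addIn.
(* The coefficients are multiples of x^S x_k with k outside S, and S + k contains a generator by
   [odd_bip_insert]. *)
have uJ T : exists w, kz v T = w *m sub_diff F 0.
  apply/sub_image/I_power => m /uE[k kT [e ->]].
  have /setDP[_ kS] : k \in W :\: S by rewrite -e setU11.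
  have [x xS nodd] := odd_bip_insert A_sym A_tf So kS.
  apply/existsP; exists (k |: S :\ x); rewrite nodd andbT cardsU1 !inE.
  rewrite (negbTE kS) andbF /= -Sc (cardsD1 x S) xS eqxx andbT.
  apply/mesym1_le => i; rewrite mnmDE mesym1_mem mnm1E !inE.
  by rewrite eq_sym => /orP[->|/andP[_ ->]]; rewrite ?addn1.
have su : supported (@sub_deg K n F 0) j (j + 2 * p + 1) (kz v).
  move=> T a m; rewrite ord1 => /uE[k kT [e ->]].
  have cT : #|T| = j by move: cWS; rewrite -e cardsU1 kT; case.
  split=> //; rewrite mdegD mdeg1 mdeg_mesym1 Sc /=; lia.
have [e [eE e0]] := boundary_of_betti0 sub_hom sub_exact su (kz_kz v) uJ b0.
set b := cmul e (sub_diff F 0) in eE.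
have bv0 : kz (b - v) = 0 by rewrite kzB -eE subrr.
have b_set0 : (b - v) set0 = 0.
  rewrite !ffunE e0 mul0mx; case: eqP => [h|_]; last by rewrite subr0.
  by move: cWS; rewrite -h cards0.
have [a||c [cE _ _]] := @kz_exact K n _ _ (fun _ _ => predT) bv0 => //.
  by rewrite b_set0 mxE mcoeff0.
pose mu := mesym1 W.
(* In multidegree W the boundary b - v pairs to zero with the dual cocycle of g. So does b: its
   coefficients lie in J, while the cocycle lives on complements of odd sets. But v pairs to a
   nonzero multiple of g S. *)
have pair0 : \sum_(T : {set 'I_n}) bd (strand c 0 mu) T * star W g T = 0.
  rewrite bd_cobd big1 // => T _.
  have [->|/strand_supp] := eqVneq (strand c 0 mu T) 0; first by rewrite mul0r.
  rewrite mesym1_leS => TW; rewrite cobd_star // => [|S' /gs[]//].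
  by rewrite g0 [X in _ * (_ * X)]ffunE !mulr0.
move: pair0; rewrite -strand_kz cE strandB.
under eq_bigr => T _ do rewrite sub_ffunE mulrBl.
rewrite sumrB [X in X - _]big1 => [|T _]; last first.
  have [->|gT] := eqVneq (star W g T) 0; first by rewrite mulr0.
  move: gT; rewrite ffunE; case: ifP => [TW|]; last by rewrite eqxx.
  rewrite mulf_eq0 signr_eq0 /= => /gs[_ Tc To].
  apply/eqP; rewrite mulf_eq0; apply/orP; left.
  apply/negPn/negP; rewrite ffunE mesym1_leS TW => h.
  have : in_power A p (mu - mesym1 T).
    apply: (I_power _).1 h; apply/sub_image; exists (e T).
    by rewrite /b ffunE.
  by rewrite in_power_setD // To.
rewrite (bigD1 (W :\: S)) //= big1 => [|T TS]; last first.
  have [->|/vE[e' _]] := eqVneq (strand v 0 mu T) 0; first by rewrite mul0r.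
  by rewrite e' eqxx in TS.
have WWS : W :\: (W :\: S) = S by rewrite setDDr setDv set0U (setIidPr SW).
apply/eqP; rewrite addr0 sub0r oppr_eq0 mulf_neq0 //.
  rewrite ffunE mesym1_leS subsetDl ffunE eqxx mxE mcoeffX.
  suff -> : (mu - mesym1 (W :\: S) = mesym1 S)%MM by rewrite eqxx oner_eq0.
  apply/mnmP => i; rewrite mnmBE !mesym1_mem inE; have := subsetP SW i.
  by case: (i \in S) => [->|]//; rewrite ?subnn.
by rewrite ffunE subsetDl WWS mulf_neq0 ?signr_eq0.
Qed.

(** The exponent of x_k stays positive after k is added to the set, and the generators are
    squarefree. So coning with k preserves coefficients in J. *)
Lemma in_power_cone (mu : 'X_{1..n}) T k : (1 < mu k)%N -> k \in T ->
  in_power A p (mu - mesym1 (T :\ k)) -> in_power A p (mu - mesym1 T).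
Proof.
move=> muk kT /existsP[W /andP[/mesym1_le h o]]; apply/existsP; exists W.
rewrite o andbT; apply/mesym1_le => i iW; have := h i iW.
rewrite !mnmBE !mesym1_mem !inE; have [->|//] := eqVneq i k.
by rewrite kT => _; lia.
Qed.

(** A cone bounds f, but its coefficient at T is outside J when W - T is odd. These coefficients are
    removed by subtracting the boundary of a chain on sets of size j + 2; by duality the obstruction
    is a facet cycle on W. *)
Lemma strand_boundary W j (f : {ffun {set 'I_n} -> K}) : #|W| = (j + 2 * p + 1)%N ->
  (forall g, facet_cycle W g -> g = 0) -> bd f = 0 ->
  (forall T, f T != 0 -> #|T| = j /\ T \subset W) ->
  exists h, bd h = f /\ forall T, h T != 0 ->
    (mesym1 T <= mesym1 W)%MM && in_power A p (mesym1 W - mesym1 T).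
Proof.
move=> Wc no_cycle f0 fs.
have [k kW] : exists k, k \in W by apply/card_gt0P; rewrite Wc addn1.
pose X := [pred T : {set 'I_n} | (T \subset W) && (#|T| == j.+2)].
pose Y := [pred T : {set 'I_n} | [&& T \subset W, #|T| == j.+1 &
   odd_bip A (W :\: T)]].
have es T : cone k f T != 0 -> T \subset W /\ #|T| = j.+1.
  move=> /cone_neq0[kT /fs[c TW]]; split.
    by rewrite -(setD1K kT) subUset sub1set kW.
  by rewrite (cardsD1 k) kT c.
have [y ys yX|h [hX hY]] := @bd_surjective_on _ _ X Y (cone k f).
  pose g : {ffun {set 'I_n} -> K} := [ffun S : {set 'I_n} => if S \subset W then
     (-1) ^+ (\sum_(i in S) inversions i W) * y (W :\: S) else 0].
  have WK S : S \subset W -> W :\: (W :\: S) = S.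
    by move=> SW; rewrite setDDr setDv set0U (setIidPr SW).
  have gy S : g S != 0 -> S \subset W /\ Y (W :\: S).
    rewrite ffunE; case: ifP => [SW|]; last by rewrite eqxx.
    by rewrite mulf_eq0 signr_eq0 /= => /ys.
  have starg : star W g = y.
    apply/ffunP=> T; rewrite ffunE; case: ifP => [TW|/negbT TW]; last first.
      by apply/esym/eqP/negPn/negP => /ys/andP[]; rewrite (negbTE TW).
    by rewrite ffunE subsetDl WK // mulrA sqr_sign mul1r.
  rewrite -starg; suff -> : g = 0.
    by apply/ffunP=> T; rewrite !ffunE mulr0 if_same.
  apply: no_cycle; split; last first.
    move=> S /gy[SW /and3P[_ /eqP c o]]; rewrite WK // in o; split=> //.
    by move: c; rewrite cardsD (setIidPr SW) Wc; have := subset_leq_card SW; lia.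
  apply/ffunP=> E; rewrite [RHS]ffunE; apply/eqP/negPn/negP => gE.
  have [l lE /gy[lW /and3P[_ /eqP c _]]] := bd_neq0 gE.
  have EW : E \subset W by apply: subset_trans lW; apply: subsetUr.
  have lWin : l \in W by apply: (subsetP lW); apply: setU11.
  (* The complement of E has j + 2 elements, which is where [cobd y] is known to vanish. *)
  have XE : X (W :\: E).
    rewrite inE subsetDl /=; apply/eqP; rewrite -c.
    rewrite (cardsD1 l (W :\: E)) inE lE lWin add1n; congr (_.+1).
    by apply: eq_card => x; rewrite !inE negb_or andbA.
  have := yX _ XE; rewrite -starg cobd_star ?subsetDl // => [|S /gy[]//].
  by rewrite WK // => /eqP; rewrite mulf_eq0 signr_eq0 (negbTE gE).
exists (cone k f - bd h); split; first by rewrite bdB bd_bd subr0 bd_cone.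
move=> T hT.
have [TW Tc] : T \subset W /\ #|T| = j.+1.
  have [e0|/es//] := eqVneq (cone k f T) 0.
  have /bd_neq0[l lT /hX/andP[lTW /eqP c]] : bd h T != 0.
    by apply: contra hT => /eqP hT; rewrite sub_ffunE e0 hT subrr.
  split; first by apply: subset_trans lTW; apply: subsetUr.
  by move: c; rewrite cardsU1 lT; case.
rewrite mesym1_leS TW /= in_power_setD //; last first.
  by rewrite cardsD (setIidPr TW) Wc Tc; lia.
apply/negP => o; have YT : Y T by rewrite inE TW Tc eqxx.
by move: hT; rewrite sub_ffunE hY // subrr eqxx.
Qed.

(** A generator would produce a Koszul cycle over J that bounds nothing over J. Yet each of its
    strands does bound: by a cone if some exponent is at least 2, and by [strand_boundary] if the
    multidegree is squarefree. *)
Lemma betti_eq0_of_acyclic j :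
  (forall W g, #|W| = (j + 2 * p + 1)%N -> facet_cycle W g -> g = 0) ->
  betti F j (j + 2 * p + 1) = 0.
Proof.
move=> no_cycle; apply/betti_eq0 => a ad.
case: (F_res) => _ _ F_min.
have min0 i : (0 < i)%N -> forall a b, (sub_diff F i a b)@_0 = 0.
  by case: i => // i _ a' b; apply: F_min.
have [u [su u0 uD []]] := nonboundary_of_betti sub_hom sub_exact
  (i := j) (min0 j.+1 isT) (min0 j) ad.
have [c0 mu|c cE cR] :=
  @kz_lift _ _ _ u (fun _ mu T => in_power A p (mu - mesym1 T)).
  have bf : bd (strand u c0 mu) = 0 by rewrite -strand_kz u0 strand0.
  have fs T : strand u c0 mu T != 0 -> [/\ #|T| = j,
      mdeg mu = (j + 2 * p + 1)%N & in_power A p (mu - mesym1 T)].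
    move=> h; have [c1 c2] := supported_strand su h.
    split=> //; first by rewrite addn0 in c2.
    have hs := strand_supp h; move: h; rewrite ffunE hs; apply: (I_power _).1.
    by rewrite ord1; apply/sub_image.
  have [f0|fn0] := eqVneq (strand u c0 mu) 0.
    by exists 0; rewrite f0 bd0; split=> // T; rewrite ffunE eqxx.
  have [k muk|sf] := pickP (fun k => 1 < mu k)%N.
    exists (cone k (strand u c0 mu)); split; first exact: bd_cone.
    move=> T /cone_neq0[kT h]; have [_ _] := fs _ h.
    move=> /(in_power_cone muk kT) ->; rewrite andbT.
    move/strand_supp/mesym1_le: h => h; apply/mesym1_le => i iT.
    have [->|ik] := eqVneq i k; first exact: ltnW.
    by apply: h; rewrite !inE ik.
  pose W := [set k | 0 < mu k]%N.
  have muE : mu = mesym1 W.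
    apply/mnmP=> i; rewrite mesym1_mem inE; have := sf i.
    by case: (mu i) => [|[|]].
  have /existsP[T0 fT0] : [exists T, strand u c0 mu T != 0].
    apply: contraT; rewrite negb_exists => /forallP h; case/eqP: fn0.
    by apply/ffunP=> T; rewrite [RHS]ffunE; apply/eqP/negPn.
  have [_ muc _] := fs _ fT0.
  have Wc : #|W| = (j + 2 * p + 1)%N by rewrite -muc muE mdeg_mesym1.
  rewrite muE; apply: (@strand_boundary W j) => //.
  - by move=> g; apply: no_cycle.
  - by rewrite -muE.
  move=> T; rewrite -muE => h; have [-> _ _] := fs _ h; split=> //.
  by rewrite -mesym1_leS -muE; apply: strand_supp h.
have /fin_all_exists[w wE] T : exists w, c T = w *m sub_diff F 0.
  apply/sub_image/I_power => m; rewrite coef_strand => /cR.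
  by rewrite addmK.
exists [ffun T => w T]; rewrite -cE; congr (kz _).
by apply/ffunP=> T; rewrite [RHS]ffunE ffunE.
Qed.

Lemma facet_cycle_support W g : (1 < p)%N ->
  (forall S X, #|S| = (2 * p).+2 -> bipartition A S X -> ~~ odd #|X| ->
     (0 < #|X|)%N -> (0 < #|S :\: X|)%N -> False) ->
  facet_cycle W g -> g <> 0 -> (4 * p + 2 <= #|W|)%N.
Proof.
move=> p1 no_even [g0 gs] gn0.
have /existsP[S gS] : [exists S, g S != 0].
  apply: contraT; rewrite negb_exists => /forallP h; case: gn0.
  by apply/ffunP=> S; rewrite [RHS]ffunE; apply/eqP/negPn.
apply: (@card_support_ge _ A A_sym A_irr A_tf (fun S => g S != 0) p W _ _ _ _
  no_even S p1 gS).
- by move=> S' /gs[].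
- by move=> S' /gs[].
- by move=> S' /gs[].
(* In the cycle equation at the ridge S' - v the term of S' is nonzero, so another facet of the
   support contains this ridge. *)
move=> S' v gS' vS'; have /ffunP/(_ (S' :\ v)) := g0.
rewrite !ffunE (bigD1 v) ?setD11 //= setD1K // => e.
have /exists_inP[w /andP[wS wv] gw] : [exists w in [pred k | (k \notin S' :\ v) && (k != v)],
    g (w |: S' :\ v) != 0].
  apply: contraTT gS'; rewrite negb_exists_in => /forall_inP h.
  move: e; rewrite big1 ?addr0 => [/eqP|k /h /negPn/eqP ->]; last by rewrite mulr0.
  by rewrite mulf_eq0 signr_eq0 negbK.
by exists w => //; move: wS; rewrite !inE wv.
Qed.

End Betti.

(** * Induced complete bipartite subgraphs *)

Lemma superset_of_card (T : finType) (W : {set T}) k :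
  (#|W| <= k <= #|T|)%N -> exists2 W' : {set T}, W \subset W' & #|W'| = k.
Proof.
move=> /andP[Wk kT]; elim: k Wk kT => [|k IH] Wk kT.
  by exists W => //; apply/eqP; rewrite -leqn0.
have [Wk'|Wk'] := leqP #|W| k; last by exists W => //; apply/eqP; rewrite eqn_leq Wk.
have [W' WW' W'k] := IH Wk' (ltnW kT).
have /set0Pn[x] : ~: W' != set0.
  by rewrite -card_gt0 -subn_gt0; have := cardsC W'; lia.
rewrite inE => xW'; exists (x |: W'); last by rewrite cardsU1 xW' W'k.
by apply: subset_trans WW' (subsetUr _ _).
Qed.

Lemma has_induced_complete_bipartite (T : finType) (A : rel T) (W X : {set T}) :
  bipartition A W X ->
  has_induced A (@complete_bipartite #|X| #|W :\: X|).
Proof.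
move=> bW; have [XW h] := bipartitionP _ _ _ bW.
pose f (x : 'I_#|X| + 'I_#|W :\: X|) :=
  match x with inl i => enum_val i | inr i => enum_val i end.
have fX i : f (inl i) \in X by apply: enum_valP.
have fXW i : f (inl i) \in W by apply: (subsetP XW).
have fY i : f (inr i) \in W :\: X by apply: enum_valP.
have fY' i : (f (inr i) \in X = false) * (f (inr i) \in W).
  by have := fY i; rewrite inE => /andP[/negbTE].
exists f; split=> [|[i|i] [j|j]]; last 4 first.
- by rewrite (h _ _ (fXW i) (fXW j)) !fX.
- by rewrite (h _ _ (fXW i) (fY' j).2) fX fY'.
- by rewrite (h _ _ (fY' i).2 (fXW j)) fX fY'.
- by rewrite (h _ _ (fY' i).2 (fY' j).2) !fY'.
move=> [i|i] [j|j] //= e.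
- by rewrite (enum_val_inj e).
- by have := fX i; rewrite /f e -[enum_val j]/(f (inr j)) fY'.
- by have := fX j; rewrite /f -e -[enum_val i]/(f (inr i)) fY'.
- by rewrite (enum_val_inj e).
Qed.

Lemma bipartition_of_has_induced (T : finType) (A : rel T) a b :
  (forall x y, A x y = A y x) -> has_induced A (@complete_bipartite a b) ->
  exists W X : {set T}, [/\ bipartition A W X, #|X| = a & #|W :\: X| = b].
Proof.
move=> A_sym [f [fI fA]].
pose X := [set f (inl i) | i in 'I_a]; pose Y := [set f (inr i) | i in 'I_b].
have dXY : [disjoint X & Y].
  rewrite -setI_eq0; apply/eqP/setP => x; rewrite !inE; apply/negP.
  by move=> /andP[/imsetP[i _ ->] /imsetP[j _ /fI]].
exists (X :|: Y), X; split.
- apply: (bipartition_join A_sym) => //.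
  + by move=> x y /imsetP[i _ ->] /imsetP[j _ ->]; rewrite fA.
  + by move=> x y /imsetP[i _ ->] /imsetP[j _ ->]; rewrite fA.
  + by move=> x y /imsetP[i _ ->] /imsetP[j _ ->]; rewrite fA.
- by rewrite card_imset ?card_ord // => i j /fI[].
have -> : (X :|: Y) :\: X = Y.
  by rewrite setDUl setDv set0U; apply/setDidPl; rewrite disjoint_sym.
by rewrite card_imset ?card_ord // => i j /fI[].
Qed.

(* From cycles in bipartite graphs and crowns to the Betti numbers *)
Local Close Scope ring_scope.

Theorem proposition5p3 (K : fieldType) (n p : nat) (D : {set {set 'I_n}})
    (D_complex : simplicial_complex D) (D_dim1 : has_dim D 1)
    (D_flag : flag K D)
    (p_ge2 : 2 <= p) (p_le_nu : p <= matching_number (co_skeleton1 D))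
    (F : graded_free K n)
    (F_res : minimal_graded_free_resolution
               (sqfree_power (@stanley_reisner K n D) p) F) :
  ((exists i : nat, [/\ ~~ odd i, i <= p &
      has_induced (skeleton1 D) (@complete_bipartite (2 + i) (2 * p - i))]) ->
    forall j : nat, 1 <= j <= n - 2 * p - 1 ->
      betti F j (j + 2 * p + 1) <> 0)
  /\
  (has_induced (skeleton1 D) (@crown (2 * p + 1)) ->
   (forall i : nat, ~~ odd i -> i <= p ->
      ~ has_induced (skeleton1 D)
          (@complete_bipartite (2 + i) (2 * p - i))) ->
   (forall j : nat, 1 <= j <= 2 * p -> betti F j (j + 2 * p + 1) = 0)
   /\
   (forall j : nat, 2 * p + 1 <= j <= n - 2 * p - 1 ->
      betti F j (j + 2 * p + 1) <> 0)).
Proof.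
have A_sym := @skeleton1_sym n D; have A_irr := @skeleton1_irr n D.
have A_tf := skeleton1_triangle_free D_complex D_dim1 D_flag.
have I_pow := sqfree_powerP D_complex D_dim1 D_flag p.
have nonzero j (W : {set 'I_n}) (g : {ffun {set 'I_n} -> K}) :
    #|W| <= j + 2 * p + 1 -> j + 2 * p + 1 <= n ->
    facet_cycle p (skeleton1 D) W g -> (exists S, g S != 0%R) ->
    betti F j (j + 2 * p + 1) <> 0.
  move=> Wj jn [g0 gs] [S gS].
  (* A cycle on W is also one on any larger vertex set, so one small W serves every admissible j. *)
  have [|W' WW' W'c] := @superset_of_card _ W (j + 2 * p + 1).
    by rewrite Wj card_ord.
  apply: (betti_neq0 A_sym A_tf F_res I_pow W'c (g := g)).
  - split=> // T /gs[TW Tc To]; split=> //; exact: subset_trans TW WW'.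
  - by move=> g00; rewrite g00 ffunE eqxx in gS.
split=> [[i [ie ip]]|].
  move=> /(bipartition_of_has_induced A_sym)[W [X [bW Xc Yc]]] j /andP[j1 jn].
  have Wc : #|W| = 2 * p + 2.
    have [XW _] := bipartitionP _ _ _ bW.
    by rewrite -(cardsID X W) (setIidPr XW) Xc Yc; lia.
  have [| | | |g [g0 gn gs]] := even_bip_cycle K A_sym bW; rewrite ?Xc ?Yc.
  - by rewrite oddD.
  - by rewrite oddB ?mul2n ?odd_double //; lia.
  - by lia.
  - by lia.
  apply: (nonzero j W g _ _ _ gn); [by rewrite Wc; lia|lia|].
  split=> // S /gs[SW Sc So]; split=> //.
  by move: Sc; rewrite Wc addn2 => -[].
move=> [f [fI fA]] no_even.
have no_bip (S X : {set 'I_n}) :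
    #|S| = (2 * p).+2 -> bipartition (skeleton1 D) S X ->
    ~~ odd #|X| -> 0 < #|X| -> 0 < #|S :\: X| -> False.
  move=> Sc bS.
  (* With X the smaller part, the index i = |X| - 2 is at most p; it is a genuine difference because
     X is even and nonempty. *)
  wlog Xp : X bS / #|X| <= p.+1.
    have [XS _] := bipartitionP _ _ _ bS.
    have c : #|X| + #|S :\: X| = #|S| by rewrite -(cardsID X S) (setIidPr XS).
    move=> wl eX X0 Y0; have [Xp|Xp] := leqP #|X| p.+1; first exact: wl Xp eX X0 Y0.
    apply: (wl (S :\: X)) => //.
    - exact: bipartitionC.
    - by lia.
    - have : ~~ odd #|S| by rewrite Sc /= negbK mul2n odd_double.
      by rewrite -c oddD (negbTE eX).
    - by rewrite (bipartition_setDK bS).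
  have [XS _] := bipartitionP _ _ _ bS.
  have c : #|X| + #|S :\: X| = #|S| by rewrite -(cardsID X S) (setIidPr XS).
  move=> eX X0 Y0; have X2 : 2 <= #|X| by case: #|X| eX X0 => [|[]].
  apply: (no_even (#|X| - 2)).
  - by rewrite oddB // addbF.
  - by lia.
  have := has_induced_complete_bipartite bS.
  have -> : 2 + (#|X| - 2) = #|X| by lia.
  by have -> : #|S :\: X| = 2 * p - (#|X| - 2) by lia.
split=> j /andP[j1 j2].
  apply: (betti_eq0_of_acyclic F_res I_pow) => //.
  (* For j at most 2p, W has at most 4p + 1 vertices, fewer than a nonzero cycle involves. *)
  move=> W g Wc gc; apply/eqP/negPn/negP => /eqP gn0.
  have := facet_cycle_support A_sym A_irr A_tf p_ge2 no_bip gc gn0.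
  lia.
have [||g [g0 gn gs]] := crown_cycle K A_sym A_irr fI _ _ fA.
- by rewrite oddD mul2n odd_double.
- by lia.
(* The crown has 4p + 2 vertices, which is j + 2p + 1 for the first value j = 2p + 1. *)
apply: (nonzero j [set f x | x in predT] g _ _ _ gn); [|lia|].
  rewrite card_imset // card_sum card_ord; lia.
split=> // S /gs[SW Sc So]; split=> //.
by move: Sc; rewrite addn1 => -[].
Qed.
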